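(* Assume CH. There is an automorphism $T:\ell_\infty/c_0\rightarrow\ell_\infty/c_0$ which is nowhere canonizable along a quasi-open map, that is, there are no infinite $A,B\subseteq\mathbb{N}$ and quasi-open map $\psi:B^*\to A^*$ such that $T_{B,A}$ is canonizable along $\psi$. In particular, $T$ is nowhere canonizable along a homeomorphism.
   Context: CH is the continuum hypothesis. $[f]$ is the class of $f$ modulo null functions. $\mathbb{N}^*=\beta\mathbb{N}\setminus\mathbb{N}$; for $A\subseteq\mathbb{N}$, $A^*=\overline{A}^{\beta\mathbb{N}}\setminus A$. $\ell_\infty(A)/c_0(A)$ is canonically identified with $C(A^* )$. An automorphism is a bounded linear bijection with bounded inverse. For infinite $A,B\subseteq\mathbb{N}$: $I_A([g])=[g\cup 0_{\mathbb{N}\setminus A}]$ for $g\in\ell_\infty(A)$, $P_B([f])=[f|B]$, and $T_{B,A}=P_B\circ T\circ I_A$. A continuous map is quasi-open if the image of every nonempty open set has nonempty interior. $T_{B,A}$ is canonizable along $\psi$ if $\psi:B^*\to A^*$ is a continuous surjection and there is a nonzero real $r$ such that $T_{B,A}$, viewed as an operator $C(A^* )\to C(B^* )$, satisfies $T_{B,A}(f)=r f\circ\psi$ for all $f\in C(A^* )$. *)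

(* Defs.v *)
From HB Require Import structures.
From mathcomp Require Import all_boot all_order all_algebra.
From mathcomp Require Import all_classical all_reals all_analysis.
From mathcomp Require Import lra.

Set Implicit Arguments.
Unset Strict Implicit.
Unset Printing Implicit Defensive.

Import Order.TTheory GRing.Theory Num.Theory.
Import numFieldNormedType.Exports.

Local Open Scope classical_set_scope.
Local Open Scope ring_scope.
Local Open Scope quotient_scope.


Definition continuum_hypothesis (R : realType) : Prop :=
  forall X : set R, countable X \/ (X #= [set: R])%card.

(* The library only provides this instance when T is infinite. *)
#[global] Instance frechet_filter_filter (T : Type) :
  Filter (@frechet_filter T).
Proof.
split; rewrite /frechet_filter /=.
- by rewrite setCT.
- by move=> P Q /= fP fQ; rewrite setCI finite_setU.
- by move=> P Q PQ; apply: sub_finite_set; exact: subsetC.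
Qed.

Section linf.
Context (R : realType) (I : Type).

Definition linf_pred : {pred I -> R^o} := fun f => `[< bounded_fun f >].

Lemma linf_predP (f : I -> R^o) :
  reflect (exists M, forall i, `|f i| <= M) (f \in linf_pred).
Proof.
rewrite unfold_in; apply: (iffP (asboolP _)).
  by move=> /pinfty_ex_gt0[M _ fM]; exists M => i; exact: fM.
move=> [M fM]; rewrite /= /bounded_near; near=> N => i _ /=.
by rewrite (le_trans (fM i)).
Unshelve. all: by end_near. Qed.

Lemma linf_submod_closed : submod_closed linf_pred.
Proof.
split; first by apply/linf_predP; exists 0 => i; rewrite normr0.
move=> a u v /linf_predP[M uM] /linf_predP[N vN].
apply/linf_predP; exists (`|a| * M + N) => i.
by rewrite (le_trans (ler_normD _ _))// lerD// normrM ler_wpM2l.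
Qed.

HB.instance Definition _ :=
  GRing.isSubmodClosed.Build R (I -> R^o) linf_pred
    (GRing.submod_closed_semi linf_submod_closed).

Record linf : Type := Linf { linf_fun : I -> R^o ; _ : linf_fun \in linf_pred }.

HB.instance Definition _ := [isSub for linf_fun].
HB.instance Definition _ := [Choice of linf by <:].
HB.instance Definition _ := [SubChoice_isSubLmodule of linf by <:].

Definition c0_pred : {pred linf} :=
  fun f => `[< linf_fun f i @[i --> (@frechet_filter I : set_system I)] --> (0 : R) >].

Lemma c0_predP (f : linf) :
  reflect (forall e, 0 < e -> finite_set [set i | e <= `|linf_fun f i|])
          (f \in c0_pred).
Proof.
have setE e : [set i | e <= `|linf_fun f i|] =
    ~` [set i | `|linf_fun f i| < e].
  by apply/seteqP; split => i /=; rewrite leNgt => /negP.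
rewrite unfold_in; apply: (iffP (asboolP _)).
  by move=> /cvgr0Pnorm_lt f0 e e0; rewrite setE; exact: f0.
by move=> f0; apply/cvgr0Pnorm_lt => e e0; have := f0 e e0; rewrite setE.
Qed.

Lemma c0_submod_closed : submod_closed c0_pred.
Proof.
split.
  rewrite unfold_in; apply/asboolP; exact: cvg_cst.
move=> a u v; rewrite !unfold_in => /asboolP u0 /asboolP v0; apply/asboolP.
have := @cvgD R R^o _ _ _ _ _ _ _ (cvgMl_tmp (a := a) u0) v0.
rewrite mulr0 addr0 => H; exact: H.
Qed.

HB.instance Definition _ :=
  GRing.isSubmodClosed.Build R linf c0_pred
    (GRing.submod_closed_semi c0_submod_closed).


Definition linf_c0 : Type := Quotient.quot c0_pred.

HB.instance Definition _ := Choice.on linf_c0.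
HB.instance Definition _ := GRing.Zmodule.on linf_c0.
HB.instance Definition _ := EqQuotient.on linf_c0.

Lemma eq_linf_c0 (f g : linf) :
  (\pi_linf_c0 f = \pi_linf_c0 g) <-> f - g \in c0_pred.
Proof.
split=> [fg|]; last by rewrite (Quotient.idealrBE c0_pred) => /eqP.
by rewrite (Quotient.idealrBE c0_pred); apply/eqP.
Qed.

Lemma pi_linf_c0D (f g : linf) :
  \pi_linf_c0 (f + g) = \pi_linf_c0 f + \pi_linf_c0 g.
Proof. exact: (Quotient.pi_add c0_pred). Qed.

Definition linf_c0_scale (a : R) (q : linf_c0) : linf_c0 :=
  \pi_linf_c0 (a *: repr q).

Lemma linf_c0_pi_scale (a : R) (f : linf) :
  linf_c0_scale a (\pi_linf_c0 f) = \pi_linf_c0 (a *: f).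
Proof.
apply/eq_linf_c0; rewrite -scalerBr rpredZ//.
by apply/eq_linf_c0; rewrite reprK.
Qed.

Lemma linf_c0W (q : linf_c0) : exists f, q = \pi_linf_c0 f.
Proof. by exists (repr q); rewrite reprK. Qed.

Lemma linf_c0_scalerA a b q :
  linf_c0_scale a (linf_c0_scale b q) = linf_c0_scale (a * b) q.
Proof. by have [f ->] := linf_c0W q; rewrite !linf_c0_pi_scale scalerA. Qed.

Lemma linf_c0_scale1r : left_id 1 linf_c0_scale.
Proof. by move=> q; have [f ->] := linf_c0W q; rewrite linf_c0_pi_scale scale1r. Qed.

Lemma linf_c0_scalerDr : right_distributive linf_c0_scale +%R.
Proof.
move=> a p q; have [f ->] := linf_c0W p; have [g ->] := linf_c0W q.
by rewrite -pi_linf_c0D !linf_c0_pi_scale scalerDr pi_linf_c0D.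
Qed.

Lemma linf_c0_scalerDl q : {morph linf_c0_scale^~ q : a b / a + b}.
Proof.
by move=> a b; have [f ->] := linf_c0W q; rewrite !linf_c0_pi_scale scalerDl pi_linf_c0D.
Qed.

HB.instance Definition _ := GRing.Zmodule_isLmodule.Build R linf_c0
  linf_c0_scalerA linf_c0_scale1r linf_c0_scalerDr linf_c0_scalerDl.

Lemma pi_linf_c0Z a (f : linf) : \pi_linf_c0 (a *: f) = a *: \pi_linf_c0 f.
Proof. by rewrite -linf_c0_pi_scale. Qed.

Definition sup_norm (f : linf) : R := sup (range (fun i => `|linf_fun f i|)).

Lemma sup_norm_ub f i : `|linf_fun f i| <= sup_norm f.
Proof.
have /linf_predP[M fM] := valP f.
by apply: ub_le_sup; [exists M => _ [j _ <-]; exact: fM|exists i].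
Qed.

Lemma sup_norm_le f (M : R) :
  0 <= M -> (forall i, `|linf_fun f i| <= M) -> sup_norm f <= M.
Proof.
move=> M0 fM; have [[i _]|I0] := pselect (exists i : I, True).
  by apply: ge_sup => [|_ [j _ <-]//]; exists `|linf_fun f i|; exists i.
have r0 : range (fun i => `|linf_fun f i|) = set0; last by rewrite /sup_norm r0 sup0.
by apply/seteqP; split => // y [i _ _]; case: I0; exists i.
Qed.

Lemma sup_norm_ge0 f : 0 <= sup_norm f.
Proof.
have [[i _]|I0] := pselect (exists i : I, True).
  exact: le_trans (sup_norm_ub f i).
have r0 : range (fun i => `|linf_fun f i|) = set0; last by rewrite /sup_norm r0 sup0.
by apply/seteqP; split => // y [i _ _]; case: I0; exists i.
Qed.

Definition quot_norm (q : linf_c0) : R :=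
  inf [set sup_norm f | f in [set f | \pi_linf_c0 f = q]].

Lemma quot_norm_has_inf q :
  has_inf [set sup_norm f | f in [set f | \pi_linf_c0 f = q]].
Proof.
split; first by exists (sup_norm (repr q)), (repr q) => //=; rewrite reprK.
by exists 0 => _ [f _ <-]; exact: sup_norm_ge0.
Qed.

Lemma quot_norm_le f : quot_norm (\pi_linf_c0 f) <= sup_norm f.
Proof. by apply: ge_inf; [exact: (quot_norm_has_inf _).2|exists f]. Qed.

Lemma quot_norm_lt q (e : R) : quot_norm q < e ->
  exists2 f, \pi_linf_c0 f = q & sup_norm f < e.
Proof.
move=> /inf_lt[|_ [f fq <-] fe]; last by exists f.
exact: (quot_norm_has_inf q).1.
Qed.

Lemma quot_norm_ge0 q : 0 <= quot_norm q.
Proof.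
apply: lb_le_inf; first exact: (quot_norm_has_inf q).1.
by move=> _ [f _ <-]; exact: sup_norm_ge0.
Qed.

Lemma quot_normD p q : quot_norm (p + q) <= quot_norm p + quot_norm q.
Proof.
apply/ler_addgt0Pr => e e0.
have /quot_norm_lt[f <- fp] : quot_norm p < quot_norm p + e / 2.
  by rewrite ltrDl divr_gt0.
have /quot_norm_lt[g <- gq] : quot_norm q < quot_norm q + e / 2.
  by rewrite ltrDl divr_gt0.
rewrite -pi_linf_c0D (le_trans (quot_norm_le _))//.
apply: (@le_trans _ _ (sup_norm f + sup_norm g)).
  apply: sup_norm_le => [|i]; first by rewrite addr_ge0 ?sup_norm_ge0.
  by rewrite (le_trans (ler_normD _ _))// lerD ?sup_norm_ub.
by rewrite [e in leRHS]splitr addrACA lerD// ltW.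
Qed.

Lemma sup_normZ a f : sup_norm (a *: f) <= `|a| * sup_norm f.
Proof.
apply: sup_norm_le => [|i]; first by rewrite mulr_ge0 ?sup_norm_ge0.
by rewrite normrM ler_wpM2l// sup_norm_ub.
Qed.

Lemma quot_normZ_le a q : quot_norm (a *: q) <= `|a| * quot_norm q.
Proof.
have [->|a0] := eqVneq a 0.
  rewrite normr0 mul0r scale0r.
  rewrite (le_trans (_ : _ <= quot_norm (\pi_linf_c0 0)))//.
    by rewrite le_eqVlt; apply/orP; left; apply/eqP; congr quot_norm; rewrite piE.
  by rewrite (le_trans (quot_norm_le _))//; apply: sup_norm_le => // i; rewrite normr0.
rewrite -ler_pdivrMl ?normr_gt0//.
apply: lb_le_inf; first exact: (quot_norm_has_inf q).1.
move=> _ [f <- <-]; rewrite ler_pdivrMl ?normr_gt0//.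
by rewrite -pi_linf_c0Z (le_trans (quot_norm_le _))// sup_normZ.
Qed.

Lemma quot_normZ a q : quot_norm (a *: q) = `|a| * quot_norm q.
Proof.
apply/eqP; rewrite eq_le quot_normZ_le/=.
have [->|a0] := eqVneq a 0; first by rewrite normr0 mul0r quot_norm_ge0.
rewrite -ler_pdivlMl ?normr_gt0// -normfV.
by rewrite -[q in leLHS](scalerK a0) quot_normZ_le.
Qed.

Lemma quot_norm0_eq0 q : quot_norm q = 0 -> q = 0.
Proof.
move=> q0; have [f qf] := linf_c0W q; subst q.
have -> : 0 = \pi_linf_c0 0 by rewrite piE.
apply/eq_linf_c0; rewrite subr0; apply/c0_predP => e e0.
have e20 : 0 < e / 2 by rewrite divr_gt0.
have /quot_norm_lt[g gf ge] : quot_norm (\pi_linf_c0 f) < e / 2 by rewrite q0.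
have /c0_predP/(_ _ e20) : f - g \in c0_pred by apply/eq_linf_c0.
apply: sub_finite_set => i /= ei.
have := le_lt_trans (sup_norm_ub g i) ge.
rewrite -[linf_fun f i](subrK (linf_fun g i)) in ei.
have := le_trans ei (ler_normD _ _); rewrite {1}[e]splitr => h1 h2.
rewrite -(lerD2r `|linf_fun g i|); apply: le_trans h1.
by rewrite lerD2l ltW.
Qed.

HB.instance Definition _ := Lmodule_isNormed.Build R linf_c0
  quot_normD quot_normZ quot_norm0_eq0.

End linf.

Arguments linf_c0 R I : clear implicits.

Section corner.
Context {R : realType}.

Lemma valL0_in (A : set nat) (g : A -> R) (a : A) : 'valL_0 g (\val a) = g a.
Proof. by have /(congr1 (@^~ a)) := valLK 0 g. Qed.

Lemma valL0_out (A : set nat) (g : A -> R) n : ~ A n -> 'valL_0 g n = 0.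
Proof.
move=> An; rewrite -(valLK 0 g) -[LHS]/((valL_ 0 \o sigL A) _ n) sigLK.
by rewrite /= patchN// notin_setE.
Qed.

Lemma ext0_subproof (A : set nat) (g : linf R A) :
  ('valL_0 (linf_fun g) : nat -> R^o) \in @linf_pred R nat.
Proof.
have /linf_predP[M gM] := valP g.
apply/linf_predP; exists (`|M|) => n.
have [An|An] := pselect (A n); last by rewrite valL0_out// normr0.
rewrite -[n]/(\val (SigSub (mem_set An) : A)) valL0_in.
by rewrite (le_trans (gM _))// ler_norm.
Qed.

Definition ext0 (A : set nat) (g : linf R A) : linf R nat :=
  Linf (ext0_subproof g).

Lemma restr_subproof (B : set nat) (f : linf R nat) :
  (sigL B (linf_fun f) : B -> R^o) \in @linf_pred R B.
Proof.
have /linf_predP[M fM] := valP f.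
by apply/linf_predP; exists M => b; exact: fM.
Qed.

Definition restr (B : set nat) (f : linf R nat) : linf R B :=
  Linf (restr_subproof B f).

(* The choice of representative is irrelevant, by linf_c0_ext_pi and
   linf_c0_restr_pi below. *)
Definition linf_c0_ext (A : set nat) (q : linf_c0 R A) : linf_c0 R nat :=
  \pi_(linf_c0 R nat) (ext0 (repr q)).

Definition linf_c0_restr (B : set nat) (q : linf_c0 R nat) : linf_c0 R B :=
  \pi_(linf_c0 R B) (restr B (repr q)).

Lemma linf_c0_ext_pi (A : set nat) (g : linf R A) :
  linf_c0_ext (\pi_(linf_c0 R A) g) = \pi_(linf_c0 R nat) (ext0 g).
Proof.
apply/eq_linf_c0; set h := repr _.
have /c0_predP hg : h - g \in @c0_pred R _ by apply/eq_linf_c0; rewrite reprK.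
apply/c0_predP => e e0.
apply: (@sub_finite_set _ _ (\val @` [set i : A | e <= `|linf_fun (h - g) i|])).
  move=> n.
  rewrite -[X in X -> _]/(is_true (e <=
    `|'valL_0 (linf_fun h) n - 'valL_0 (linf_fun g) n|)).
  have [An|An] := pselect (A n); last first.
    by rewrite !valL0_out// subr0 normr0 leNgt e0.
  rewrite -[n]/(\val (SigSub (mem_set An) : A)) !valL0_in => en.
  by exists (SigSub (mem_set An)).
exact/finite_image/hg.
Qed.

Lemma linf_c0_restr_pi (B : set nat) (f : linf R nat) :
  linf_c0_restr B (\pi_(linf_c0 R nat) f) = \pi_(linf_c0 R B) (restr B f).
Proof.
apply/eq_linf_c0; set h := repr _.
have /c0_predP hf : h - f \in @c0_pred R _ by apply/eq_linf_c0; rewrite reprK.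
apply/c0_predP => e e0.
apply: (@finite_preimage B nat [set i | e <= `|linf_fun (h - f) i|] \val).
  by move=> x y _ _; exact: val_inj.
exact: hf.
Qed.

(* T_{B,A} = P_B \o T \o I_A *)
Definition corner (B A : set nat) (T : linf_c0 R nat -> linf_c0 R nat)
    (q : linf_c0 R A) : linf_c0 R B :=
  linf_c0_restr B (T (linf_c0_ext q)).

End corner.

Arguments corner {R} B A T q.

(* The Stone-Cech compactification of the discrete space of naturals, realised
   as the Stone space of ultrafilters. *)
Record betaN : Type := BetaN {
  ultra_of : set_system nat;
  ultra_ofP : UltraFilter ultra_of
}.

#[global] Existing Instance ultra_ofP.

Lemma betaN_inj (u v : betaN) : ultra_of u = ultra_of v -> u = v.
Proof.
case: u v => [u uP] [v vP] /= uv; subst v; congr BetaN.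
exact: Prop_irrelevance.
Qed.

HB.instance Definition _ := gen_eqMixin betaN.
HB.instance Definition _ := gen_choiceMixin betaN.

Definition betaN_basic (A : set nat) : set betaN := [set u | ultra_of u A].

Lemma betaN_cover : \bigcup_(A in [set: set nat]) betaN_basic A = setT.
Proof. by apply/seteqP; split => // u _; exists setT => //; exact: filterT. Qed.

Lemma betaN_join (A B : set nat) (u : betaN) : setT A -> setT B ->
  betaN_basic A u -> betaN_basic B u ->
  exists C, [/\ setT C, betaN_basic C u &
    betaN_basic C `<=` betaN_basic A `&` betaN_basic B].
Proof.
move=> _ _ uA uB; exists (A `&` B); split => //; first exact: filterI.
by move=> v vAB; split; apply: filterS vAB => n [].
Qed.

HB.instance Definition _ := isBaseTopological.Build betaN betaN_cover betaN_join.

Definition betaN_pure (n : nat) : betaN := BetaN (principal_filter_ultra n).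

(* A^* in betaN; used as a topological space through set_type. *)
Definition star (A : set nat) : set betaN :=
  closure (betaN_pure @` A) `\` (betaN_pure @` A).

Lemma betaN_basic_open A : open (betaN_basic A).
Proof. by exists [set A] => //; rewrite bigcup_set1. Qed.

Lemma nbhs_betaN (u : betaN) (U : set betaN) :
  nbhs u U <-> exists2 A, ultra_of u A & betaN_basic A `<=` U.
Proof.
rewrite nbhsE; split=> [[V [[D _ <-] [A DA uA]] VU]|[A uA AU]].
  by exists A => // v vA; apply: VU; exists A.
by exists (betaN_basic A) => //; split => //; exact: betaN_basic_open.
Qed.

Lemma ultra_meet (F : set_system nat) (FF : ProperFilter F) A B :
  F A -> F B -> exists n, A n /\ B n.
Proof. by move=> FA FB; exact: filter_ex (filterI FA FB). Qed.

Lemma ultra_setC (u : betaN) A : ultra_of u (~` A) <-> ~ ultra_of u A.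
Proof.
split=> [uC uA|nA]; last by have [] := in_ultra_setVsetC A (ultra_ofP u).
by have [n []] := ultra_meet _ uA uC.
Qed.

Lemma betaN_pureE n A : ultra_of (betaN_pure n) A <-> A n.
Proof. exact: principal_filterP. Qed.

Lemma ultra_set1 (u : betaN) n : ultra_of u [set n] -> u = betaN_pure n.
Proof.
move=> un; apply: betaN_inj; apply/seteqP; split => A.
  move=> uA; apply/betaN_pureE.
  by have [m [/= -> ]] := ultra_meet _ un uA.
by move=> /betaN_pureE An; apply: filterS un => m /= ->.
Qed.

Lemma closure_pureE (A : set nat) :
  closure (betaN_pure @` A) = betaN_basic A.
Proof.
apply/seteqP; split=> u; last first.
  move=> uA U /nbhs_betaN[B uB BU].
  have [n [An Bn]] := ultra_meet _ uA uB.
  by exists (betaN_pure n); split; [exists n|apply: BU; apply/betaN_pureE].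
move=> uA; apply: contrapT => /ultra_setC uC.
have /uA [_ [[n An <-]]] : nbhs u (betaN_basic (~` A)).
  by apply/nbhs_betaN; exists (~` A).
by move=> /betaN_pureE.
Qed.

Lemma ultra_free (u : betaN) : (forall n, u <> betaN_pure n) ->
  forall A, finite_set (~` A) -> ultra_of u A.
Proof.
move=> uN A /finite_setP[k]; elim: k A => [|k IH] A.
  rewrite II0 card_eq0 => /eqP A0.
  by rewrite -(setCK A) A0 setC0; exact: filterT.
move=> /eq_cardSP[n An kA].
have : ultra_of u (A `|` [set n]).
  by apply: IH; rewrite setCU -setDE.
have : ultra_of u (~` [set n]).
  by apply/ultra_setC => /ultra_set1; exact: uN.
move=> uC uU; apply: filterS (filterI uC uU) => m [/= mn [//|/= mn']].
by case: mn.
Qed.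

Lemma starP (A : set nat) (u : betaN) :
  star A u <-> ultra_of u A /\ (forall B, finite_set (~` B) -> ultra_of u B).
Proof.
rewrite /star closure_pureE; split=> [[uA uN]|[uA uF]]; split => //.
- apply: ultra_free => n un; apply: uN; exists n => //.
  by move: uA; rewrite un => /betaN_pureE.
- move=> [n An nu]; have := uF (~` [set n]).
  by rewrite setCK -nu => /(_ (finite_set1 n))/betaN_pureE /= ; exact.
Qed.

Lemma betaN_compact : compact [set: betaN].
Proof.
rewrite compact_ultra => F FU _.
pose u : set_system nat := [set A | F (betaN_basic A)].
have uF : ProperFilter u.
  apply: Build_ProperFilter_ex => [A uA|].
    have [v vA] := @filter_ex _ F _ _ uA.
    exact: (@filter_ex _ (ultra_of v)).
  split=> [|A B uA uB|A B AB uA]; rewrite /u /=.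
  - by apply: filterS filterT => v _; exact: filterT.
  - by apply: filterS (@filterI _ F _ _ _ uA uB) => v [vA vB]; exact: filterI.
  - by apply: (@filterS _ F _ _ _ _ uA) => v; exact: filterS.
have uU : UltraFilter u.
  split => // G GF uG; apply/seteqP; split => // A GA.
  have [//|FC] := in_ultra_setVsetC (betaN_basic A) FU.
  have /uG GC : u (~` A).
    by apply: filterS FC => v /= vA; exact/ultra_setC.
  by have [n []] := ultra_meet _ GA GC.
exists (BetaN uU); split => // U /nbhs_betaN[A uA AU].
exact: (@filterS _ F _ _ _ AU uA).
Qed.

Lemma betaN_hausdorff : hausdorff_space betaN.
Proof.
move=> u v uv; apply: betaN_inj.
have main w w' : cluster (nbhs w) w' -> ultra_of w `<=` ultra_of w'.
  move=> ww' A wA; apply: contrapT => /ultra_setC w'A.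
  have [z [zA zC]] := ww' (betaN_basic A) (betaN_basic (~` A))
    ltac:(by apply/nbhs_betaN; exists A)
    ltac:(by apply/nbhs_betaN; exists (~` A)).
  by have [n []] := ultra_meet _ zA zC.
apply/seteqP; split; first exact: main.
by apply: main => B C uB vC; rewrite setIC; exact: uv.
Qed.

Lemma betaN_normal : normal_space betaN.
Proof. exact: compact_normal betaN_hausdorff betaN_compact. Qed.

Lemma star_closed A : closed (star A).
Proof.
have -> : star A = ~` (betaN_basic (~` A) `|` \bigcup_n betaN_basic [set n]).
  apply/seteqP; split=> u.
    move=> /starP[uA uF] [/ultra_setC//|[n _ un]].
    have := uF (~` [set n]); rewrite setCK => /(_ (finite_set1 n))/ultra_setC.
    exact.
  move=> uN; apply/starP; split.
    by apply: contrapT => /ultra_setC uA; apply: uN; left.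
  apply: ultra_free => n un; apply: uN; right; exists n => //.
  by rewrite un; apply/betaN_pureE.
apply: open_closedC; apply: openU; first exact: betaN_basic_open.
by apply: bigcup_open => n _; exact: betaN_basic_open.
Qed.

Section star_fun.
Context {R : realType}.

Lemma dist_half2 (x y a e : R) :
  `|x - a| < e / 2 -> `|y - a| < e / 2 -> `|x - y| < e.
Proof. by rewrite !ltr_norml => /andP[? ?] /andP[? ?]; apply/andP; split; lra. Qed.

Lemma dist_half3 (x y a b d e : R) :
  `|x - a| < d / 2 -> `|y - b| < d / 2 -> `|a - b| < e -> `|x - y| <= e + d.
Proof.
rewrite !ltr_norml ler_norml => /andP[? ?] /andP[? ?] /andP[? ?].
by apply/andP; split; lra.
Qed.

(* The value at u of the continuous extension of f to betaN. *)
Definition beta_ext (f : linf R nat) (u : betaN) : R :=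
  lim (linf_fun f n @[n --> ultra_of u]).

Lemma beta_ext_cvg (f : linf R nat) (u : betaN) :
  (linf_fun f n : R) @[n --> ultra_of u] --> beta_ext f u.
Proof.
have /linf_predP[M fM] := valP f.
have uM : ultra_of u ((linf_fun f : nat -> R) @^-1` `[- M, M]%classic).
  by apply: filterS filterT => n _ /=; have := fM n; rewrite ler_norml in_itv.
have [p [_ pu]] := @segment_compact R (- M) M
  (fmap (linf_fun f : nat -> R) (ultra_of u)) _ uM.
suff fp : (linf_fun f n : R) @[n --> ultra_of u] --> p.
  by rewrite /beta_ext (cvg_lim _ fp)//; exact: Rhausdorff.
move=> U pU; apply: contrapT => nU.
have uC : ultra_of u (~` ((linf_fun f : nat -> R) @^-1` U)) by exact/ultra_setC.
by have [x []] := pu (~` U) U uC pU.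
Qed.

Lemma beta_ext_approx (f : linf R nat) (u : betaN) e : 0 < e ->
  ultra_of u [set n | `|beta_ext f u - linf_fun f n| < e].
Proof. by move=> e0; have /cvgrPdist_lt := @beta_ext_cvg f u; exact. Qed.

Lemma beta_ext_dist (f g : linf R nat) (u : betaN) e : 0 < e ->
  ultra_of u [set n | `|linf_fun f n - linf_fun g n| < e] ->
  `|beta_ext f u - beta_ext g u| <= e.
Proof.
move=> e0 ufg; apply/ler_addgt0Pr => d d0.
have d20 : 0 < d / 2 by rewrite divr_gt0.
have [n [[fn gn] fgn]] := ultra_meet _
  (filterI (beta_ext_approx f u d20) (beta_ext_approx g u d20)) ufg.
exact: dist_half3 fn gn fgn.
Qed.

Lemma beta_ext_eq (f g : linf R nat) (u : betaN) :
  (forall e, 0 < e -> ultra_of u [set n | `|linf_fun f n - linf_fun g n| < e]) ->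
  beta_ext f u = beta_ext g u.
Proof.
move=> ufg; apply/eqP; rewrite -subr_eq0 -normr_le0.
by apply/ler_addgt0Pr => e e0; rewrite add0r; exact: beta_ext_dist (ufg _ e0).
Qed.

Lemma beta_ext_continuous (f : linf R nat) : continuous (beta_ext f).
Proof.
move=> u; apply/(@cvgrPdist_lt _ _ _ (nbhs u)) => e e0.
have e20 : 0 < e / 2 by rewrite divr_gt0.
apply/nbhs_betaN; exists [set n | `|beta_ext f u - linf_fun f n| < e / 2].
  exact: beta_ext_approx.
move=> v vA /=.
have [n [/= h1 h2]] := ultra_meet _ vA (beta_ext_approx f v e20).
exact: dist_half2 h1 h2.
Qed.

Lemma star_beta_ext_pi (A : set nat) (f g : linf R A) (u : star A) :
  \pi_(linf_c0 R A) f = \pi_(linf_c0 R A) g ->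
  beta_ext (ext0 f) (\val u) = beta_ext (ext0 g) (\val u).
Proof.
move=> fg; have : \pi_(linf_c0 R nat) (ext0 f) = \pi_(linf_c0 R nat) (ext0 g).
  by rewrite -!linf_c0_ext_pi fg.
move=> /eq_linf_c0/c0_predP d0; apply: beta_ext_eq => e /d0 fin.
have /starP[_] := set_valP u; apply.
apply: sub_finite_set fin => n /= /negP; rewrite -leNgt; exact.
Qed.

Lemma star_fun_continuous (A : set nat) (q : linf_c0 R A) :
  continuous ((fun u => beta_ext (ext0 (repr q)) (\val u)) : star A -> R).
Proof.
move=> u; apply: (@continuous_comp (star A) betaN R).
  exact: initial_continuous.
exact: beta_ext_continuous.
Qed.

(* The canonical identification of linf(A)/c0(A) with C(star A); it is bijective
   by star_funK and star_fun_invK below. *)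
Definition star_fun (A : set nat) (q : linf_c0 R A) :
    continuousType (star A) R :=
  mkcts (@star_fun_continuous A q).

Lemma star_funE (A : set nat) (f : linf R A) (u : star A) :
  star_fun (\pi_(linf_c0 R A) f) u = beta_ext (ext0 f) (\val u).
Proof. by apply: star_beta_ext_pi; rewrite reprK. Qed.

Lemma star_fun_inj (A : set nat) : injective (@star_fun A).
Proof.
move=> p q; have [f ->] := linf_c0W p; have [g ->] := linf_c0W q => fg.
apply/eq_linf_c0/c0_predP => e e0; apply: contrapT => Einf.
pose D := \val @` [set i : A | e <= `|linf_fun (f - g) i|].
have Dinf : infinite_set D.
  apply: contra_not Einf => Dfin.
  apply: sub_finite_set (_ : finite_set ((\val : A -> nat) @^-1` D)).
    by move=> i iE; exists i.
  by apply: finite_preimage Dfin => x y _ _; exact: val_inj.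
have FF : ProperFilter (within D (@frechet_filter nat)).
  split; last exact: within_filter.
  rewrite /within /frechet_filter /= => fD; apply: Dinf.
  by apply: sub_finite_set fD => n Dn; exact.
have [U [UU DU]] := ultraFilterLemma FF.
pose u := BetaN UU.
have uD : ultra_of u D.
  apply: DU; rewrite /within /frechet_filter /=.
  apply: (sub_finite_set _ (finite_set0 nat)) => n /=; exact.
have uA : star A u.
  apply/starP; split.
    by apply: filterS uD => _ [i _ <-]; exact: set_valP.
  move=> B fB; apply: DU; rewrite /within /frechet_filter /=.
  by apply: sub_finite_set fB => n /= nB Bn; apply: nB.
have e30 : 0 < e / 2 by rewrite divr_gt0.
have /(congr1 (fun h : continuousType (star A) R =>
  h (SigSub (mem_set uA) : star A))) := fg.
rewrite !star_funE /= => fgu.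
have [n [[fn gn] [i ei ni]]] := ultra_meet _
  (filterI (beta_ext_approx (ext0 f) u e30) (beta_ext_approx (ext0 g) u e30)) uD.
have E (h : linf R A) : linf_fun (ext0 h) n = linf_fun h i.
  by rewrite -ni; exact: (@valL0_in R A (linf_fun h) i).
move: fn gn; rewrite /mkset (E f) (E g) fgu => fn gn.
have : `|linf_fun f i - linf_fun g i| < e.
  by rewrite distrC in fn; rewrite distrC in gn; exact: dist_half2 fn gn.
by rewrite ltNge ei.
Qed.

Lemma star_fun_surj (A : set nat) (h : continuousType (star A) R) :
  exists q, star_fun q = h.
Proof.
have hc : {within star A, continuous ('valL_0 h)}.
  by apply/subspace_valL_continuousP'; exact: cts_fun.
have [M [M0 hM]] : exists M, 0 < M /\ forall u, star A u -> `|'valL_0 h u| <= M.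
  have cA : compact (star A).
    exact: (subclosed_compact (@star_closed A) betaN_compact).
  have /compact_bounded := continuous_compact hc cA.
  move=> /pinfty_ex_gt0[M M0 hM]; exists M; split => // u uA.
  by apply: hM; exists u.
have [g [gh gc gM]] := @continuous_bounded_extension betaN R betaN_normal
  (star A) (@star_closed A) ('valL_0 h) M M0 hc hM.
have gb : ((fun i : A => g (betaN_pure (\val i))) : A -> R^o) \in @linf_pred R A.
  by apply/linf_predP; exists M.
exists (\pi_(linf_c0 R A) (Linf gb)).
apply/continuousEP => u; rewrite star_funE.
have -> : h u = g (\val u).
  rewrite -gh; last exact: mem_set (set_valP u).
  by have /(congr1 (@^~ u)) := valLK 0 (h : star A -> R).
have /starP[uA _] := set_valP u.
apply/eqP; rewrite -subr_eq0 -normr_le0; apply/ler_addgt0Pr => e e0.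
have e20 : 0 < e / 2 by rewrite divr_gt0.
have /cvgrPdist_lt/(_ _ e20)/nbhs_betaN[B uB BU] := gc (\val u).
have [n [[An Bn] h1]] := ultra_meet _ (filterI uA uB)
  (beta_ext_approx (ext0 (Linf gb)) (\val u) e20).
have E : linf_fun (ext0 (Linf gb)) n = g (betaN_pure n).
  exact: (@valL0_in R A (linf_fun (Linf gb)) (SigSub (mem_set An))).
move: h1; rewrite /mkset E => h1.
have /BU /= h2 : betaN_basic B (betaN_pure n) by exact/betaN_pureE.
rewrite add0r ltW// distrC; exact: dist_half2 h2 h1.
Qed.

Definition star_fun_inv (A : set nat) (h : continuousType (star A) R) :
    linf_c0 R A :=
  sval (cid (star_fun_surj h)).

Lemma star_fun_invK A : cancel (@star_fun_inv A) (@star_fun A).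
Proof. by move=> h; rewrite /star_fun_inv; case: cid. Qed.

Lemma star_funK A : cancel (@star_fun A) (@star_fun_inv A).
Proof. by move=> q; apply: star_fun_inj; rewrite star_fun_invK. Qed.

(* T_{B,A} viewed as an operator C(star A) -> C(star B). *)
Definition corner_star (B A : set nat) (T : linf_c0 R nat -> linf_c0 R nat)
    (f : continuousType (star A) R) : continuousType (star B) R :=
  star_fun (corner B A T (star_fun_inv f)).

End star_fun.

Arguments corner_star {R} B A T f.

Definition bounded_operator (R : realType) (V W : normedModType R)
    (T : V -> W) : Prop :=
  exists M : R, forall x, `|T x| <= M * `|x|.

Definition automorphism (R : realType) (V : normedModType R)
    (T : {linear V -> V}) : Prop :=
  bounded_operator T /\
  exists S : V -> V, [/\ cancel T S, cancel S T & bounded_operator S].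

Definition quasi_open (X Y : topologicalType) (psi : X -> Y) : Prop :=
  continuous psi /\
  forall U : set X, open U -> U !=set0 -> interior (psi @` U) !=set0.

Definition homeomorphism (X Y : topologicalType) (psi : X -> Y) : Prop :=
  continuous psi /\
  exists phi : Y -> X, [/\ continuous phi, cancel psi phi & cancel phi psi].

Definition canonizable_along (R : realType) (A B : set nat)
    (T : linf_c0 R nat -> linf_c0 R nat) (psi : star B -> star A) : Prop :=
  [/\ continuous psi, set_surj setT setT psi &
    exists2 r : R, r != 0 &
      forall (f : continuousType (star A) R) (u : star B),
        corner_star B A T f u = r * f (psi u)].

Lemma homeomorphism_quasi_open (X Y : topologicalType) (psi : X -> Y) :
  homeomorphism psi -> quasi_open psi.
Proof.
move=> [cpsi [phi [cphi psiK phiK]]]; split => // U oU [x Ux].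
have -> : psi @` U = phi @^-1` U.
  apply/seteqP; split=> [_ [y Uy <-]|y Uy] /=; first by rewrite psiK.
  by exists (phi y).
exists (psi x); have /continuousP/(_ _ oU) := cphi.
by rewrite openE => /(_ (psi x)); apply; rewrite /= psiK.
Qed.

(* Main.v *)
Require Import Defs.
From HB Require Import structures.
From mathcomp Require Import all_boot all_order all_algebra.
From mathcomp Require Import all_classical all_reals all_analysis.
From mathcomp Require Import lra zify wochoice.

Set Implicit Arguments.
Unset Strict Implicit.
Unset Printing Implicit Defensive.

Import Order.TTheory GRing.Theory Num.Theory.
Import numFieldNormedType.Exports.

Local Open Scope classical_set_scope.
Local Open Scope ring_scope.
Local Open Scope quotient_scope.

(** The automorphism is built in larger-looking models of [linf / c0]. A family
of rows [F : nat -> nat -> R] has the functions [F n] as its rows, and families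
are considered up to families whose rows tend uniformly to 0. When the rows are
taken in the algebra of continuous functions on a compact zero-dimensional
space K, restricted to a dense copy of [nat], the quotient is the space of
continuous functions on the Stone-Cech remainder of the product of [nat] and K.
By Parovichenko's theorem, CH makes all these remainders homeomorphic to the
remainder of [nat]. What is used here is the resulting identification of the
function spaces, [matching_exists]: a relation between families, total on both
sides, such that related finite tuples of families have the same cluster values
at infinity. It is built by a back-and-forth of length omega_1 whose successor
step is [one_point_extension].

Three row spaces occur. Constant rows ([K] a point) give [linf / c0] itself.
[dyadic_rows] is the space of uniformly continuous functions for the 2-adic
metric ([K] is the space of 2-adic integers, which has no isolated point).
[dyadic_plus_null_rows] adds [c0] to it ([K] now has the dense set [nat] of
isolated points, accumulating at the 2-adic integers). These two Banach spaces
are isomorphic, because [dyadic_rows] contains a complemented copy of [c0],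
given by the coordinates [g (2 ^ n) - g 0], and [c0] is isomorphic to its own
square. The explicit isomorphism [shuffle] computes each value of the image
from at most five values of its argument. Applying [shuffle] to every row and
conjugating by the two identifications with [linf / c0] gives the automorphism
[T] ([automorphism_of_graph]).

The reason why [T] is nowhere canonizable is the mismatch of isolated points.
On the target side an infinite set [B] can be shrunk to an infinite [B']
representing a single isolated point in each row ([isolated_refinement]). At
these points [T f] only depends on five values of each row of [f], and since
the source has no isolated points, every infinite [A1] contains an infinite
[A2] whose representation avoids these five points ([avoiding_refinement]).
Hence [T 1_A2] vanishes on the remainder of [B'] ([locally_vanishing]). If a
corner of [T] were [f |-> r (f \o psi)] with [psi] quasi-open, then the image
under [psi] of the remainder of [B'] would contain the remainder of some
infinite [A1], hence that of [A2]; there [r 1_A2] is equal to [r], which is not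
zero. *)

(** * Recursion of length omega_1 *)

Lemma CH_well_order (R : realType) : continuum_hypothesis R ->
  exists lt : R -> R -> Prop,
    [/\ well_founded lt, forall x y, [\/ lt x y, x = y | lt y x] &
        forall x, countable [set y | lt y x]].
Proof.
move=> CH; have [le leP] := well_ordering_principle (R : eqType).
pose lt0 x y := (x != y) && le x y.
have le_min (P : set R) : P !=set0 -> exists2 z, P z & forall x, P x -> le z x.
  move=> [x Px]; have [|z [[Pz zP] _]] := leP (fun y => `[< P y >]).
    by exists x; apply/asboolP.
  by exists z => [|y Py]; [exact/asboolP|apply/zP/asboolP].
have le_tot x y : le x y \/ le y x.
  have [z [->|->] zP] := le_min [set x; y] (ex_intro _ x (or_introl erefl)).
    by left; apply: zP; right.
  by right; apply: zP; left.
have le_anti x y : le x y -> le y x -> x = y.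
  move=> xy yx; have [|z [_ zuniq]] := leP (pred2 x y); first by exists x; rewrite !inE eqxx.
  have le_refl t : le t t by case: (le_tot t t).
  rewrite -(zuniq x) ?(zuniq y)//; split; rewrite ?inE ?eqxx ?orbT//.
    by move=> t /orP[]/eqP ->.
  by move=> t /orP[]/eqP ->.
have lt0_tot x y : [\/ lt0 x y, x = y | lt0 y x].
  rewrite /lt0 eq_sym; have [->|xy] := eqVneq y x; first by constructor 2.
  by have [->|->] := le_tot x y; [constructor 1|constructor 3].
have lt0_wf : well_founded lt0.
  move=> x; apply: contrapT => nx.
  have [z nz zP] := le_min (fun y => ~ Acc lt0 y) (ex_intro _ x nx).
  apply: nz; constructor => y /andP[yz le_yz]; apply: contrapT => /zP le_zy.
  by move/eqP: yz; apply; exact: le_anti.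
(* If some initial segment is uncountable, the shortest such segment has the
   size of R by CH, and its order is pulled back to R. *)
have [cnt|/existsNP[x0 nx0]] :=
  pselect (forall x, countable [set y | lt0 y x]); first by exists lt0.
have [x nx xmin] := le_min (fun y => ~ countable [set z | lt0 z y])
  (ex_intro _ x0 nx0).
have [//|/card_eqPle[_ /pcard_leP[f]]] := CH [set y | lt0 y x].
have fx y : lt0 (f y) x by exact: (@funS _ _ _ _ f y I).
have f_inj : injective f by move=> y z; apply: (@inj _ _ _ f); rewrite inE.
exists (fun y z => lt0 (f y) (f z)); split.
- move=> y; move: {2}(f y) (erefl (f y)) => t; elim/(well_founded_ind lt0_wf): t y.
  by move=> t IH y fy; constructor => z zy; apply: (IH (f z)); rewrite -?fy.
- move=> y z; have [h|/f_inj ->|h] := lt0_tot (f y) (f z).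
  + by constructor 1.
  + by constructor 2.
  + by constructor 3.
- move=> y; have : countable [set z | lt0 z (f y)].
    apply: contrapT => /xmin xfy; have /andP[/eqP fyx le_fyx] := fx y.
    by apply: fyx; exact: le_anti.
  move=> /countable_injP[g g_inj]; apply/countable_injP; exists (g \o f) => a b.
  by rewrite !inE => fa fb /g_inj; rewrite !inE => /(_ fa fb)/f_inj.
Qed.

Definition finitely_good (T : Type) (P : nat -> (nat -> T) -> Prop)
    (rho : set T) : Prop :=
  forall L p, (forall i, (i < L)%N -> rho (p i)) -> P L p.

(** Since being good is tested on finite tuples, it passes to unions of chains. So
the tasks [covers j] can be performed one after the other along an order of
type omega_1, each one starting from the countable good relation obtained so
far. *)
Lemma transfinite_exhaustion (R : realType) (T J : Type) (code : J -> R)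
    (P : nat -> (nat -> T) -> Prop) (covers : J -> set T -> Prop) :
  continuum_hypothesis R -> injective code ->
  finitely_good P set0 ->
  (forall j rho rho', rho `<=` rho' -> covers j rho -> covers j rho') ->
  (forall rho j, countable rho -> finitely_good P rho ->
    exists rho', [/\ rho `<=` rho', countable rho', finitely_good P rho' &
                     covers j rho']) ->
  exists2 rho, finitely_good P rho & forall j, covers j rho.
Proof.
move=> /CH_well_order[lt [lt_wf lt_tot lt_cnt]] code_inj good0 covS step.
pose next (x : R) (rho : set T) : set (set T) := [set rho' |
  [/\ rho `<=` rho', countable rho', finitely_good P rho' &
      forall j, code j = x -> covers j rho']].
have nextP x rho : countable rho -> finitely_good P rho -> next x rho !=set0.
  move=> crho grho; have [[j jx]|nj] := pselect (exists j, code j = x).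
    have [rho' [h1 h2 h3 h4]] := step rho j crho grho; exists rho'; split => // k.
    by rewrite -jx => /code_inj ->.
  by exists rho; split => // j jx; case: nj; exists j.
pose rec x (below : forall y, lt y x -> set T) : set T :=
  xget set0 (next x [set t | exists y (yx : lt y x), below y yx t]).
pose r := Fix lt_wf (fun=> set T) rec.
pose below x := \bigcup_(y in [set y | lt y x]) r y.
have rE x : r x = xget set0 (next x (below x)).
  rewrite /r Fix_eq; last first.
    move=> z f g fg; rewrite /rec; congr (xget _ (next z _)).
    by apply/seteqP; split=> t [y [yz]]; [rewrite fg|rewrite -fg] => h; exists y, yz.
  rewrite /rec; congr (xget _ (next x _)); apply/seteqP; split=> t.
    by move=> [y [yx h]]; exists y.
  by move=> [y yx h]; exists y, yx.
have good_union (D : set R) :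
    (forall y, D y -> finitely_good P (r y)) ->
    (forall y z, D y -> D z -> lt y z -> r y `<=` r z) ->
    finitely_good P (\bigcup_(y in D) r y).
  move=> goodD monoD [|L] p pD; first by apply: good0.
  suff [y Dy py] : exists2 y, D y & forall i, (i < L.+1)%N -> r y (p i).
    exact: goodD py.
  elim: L pD => [|L IH] pD.
    have [//|y Dy py] := pD 0%N; exists y => // i.
    by rewrite ltnS leqn0 => /eqP ->.
  have [|y Dy py] := IH; first by move=> i /ltnW; exact: pD.
  have [//|z Dz pz] := pD L.+1.
  have [yz|yz|zy] := lt_tot y z.
  - exists z => // i; rewrite ltnS leq_eqVlt => /orP[/eqP -> //|iL].
    by apply: monoD yz _ _ => //; exact: py.
  - exists z => // i; rewrite ltnS leq_eqVlt => /orP[/eqP -> //|iL].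
    by rewrite -yz; exact: py.
  - exists y => // i; rewrite ltnS leq_eqVlt => /orP[/eqP ->|iL].
      by apply: monoD zy _ _.
    exact: py.
have rP x : next x (below x) (r x).
  elim/(well_founded_ind lt_wf): x => x IH; rewrite rE; apply: xgetPex.
  apply: nextP; first by apply: bigcup_countable => // y /IH[].
  apply: good_union => [y /IH[//]|y z yx zx yz].
  by have [sub _ _ _] := IH _ zx; apply: subset_trans sub => t ?; exists y.
exists (\bigcup_(y in setT) r y).
  apply: good_union => [y _|y z _ _ yz]; first by have [] := rP y.
  by have [sub _ _ _] := rP z; apply: subset_trans sub => t ?; exists y.
move=> j; have [_ _ _ /(_ j erefl)] := rP (code j).
by apply: covS => t ?; exists (code j).
Qed.

Section ternary_code.
Context (R : realType).

(** The digits 0 and 1 in base 3 determine the number: the tail after a digit is at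
most half of the weight of that digit. *)
Definition ternary_sum (A : set nat) (n : nat) : R :=
  \sum_(i < n) (if `[< A i >] then 3^-1 ^+ i else 0).

Lemma ternary_sum_tail (A : set nat) n m : (n <= m)%N ->
  ternary_sum A m <=
  ternary_sum A n + 3 / 2 * 3^-1 ^+ n - 3 / 2 * 3^-1 ^+ m.
Proof.
elim: m => [|m IH]; first by rewrite leqn0 => /eqP ->; lra.
rewrite leq_eqVlt => /orP[/eqP ->|]; first lra.
rewrite ltnS => /IH; rewrite /ternary_sum big_ord_recr /= exprS.
have : 0 <= 3^-1 ^+ m :> R by rewrite exprn_ge0.
case: ifP => _; lra.
Qed.

Lemma ternary_sum_le (A : set nat) n m : (n <= m)%N ->
  ternary_sum A n <= ternary_sum A m.
Proof.
elim: m => [|m IH]; first by rewrite leqn0 => /eqP ->.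
rewrite leq_eqVlt => /orP[/eqP -> //|]; rewrite ltnS => /IH h.
rewrite (le_trans h)// /ternary_sum big_ord_recr /= lerDl.
by case: ifP => // _; rewrite exprn_ge0.
Qed.

Definition ternary_code (A : set nat) : R := sup (range (ternary_sum A)).

Lemma ternary_sum_ubound A : ubound (range (ternary_sum A)) (3 / 2).
Proof.
move=> _ [n _ <-]; have := ternary_sum_tail A (leq0n n).
have : 0 <= 3^-1 ^+ n :> R by rewrite exprn_ge0.
rewrite /ternary_sum big_ord0 expr0; lra.
Qed.

Lemma ternary_code_lt (A B : set nat) n :
  (forall i, (i < n)%N -> A i <-> B i) -> A n -> ~ B n ->
  ternary_code B < ternary_code A.
Proof.
move=> AB An Bn.
have sumE : ternary_sum A n = ternary_sum B n.
  by apply: eq_bigr => i _; rewrite (asbool_equiv_eq (AB i (ltn_ord i))).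
have hA : ternary_sum B n + 3^-1 ^+ n <= ternary_code A.
  rewrite -sumE (_ : _ + _ = ternary_sum A n.+1); last first.
    by rewrite [RHS]/ternary_sum big_ord_recr /= asboolT.
  by apply: ub_le_sup; [exists (3 / 2); exact: ternary_sum_ubound|exists n.+1].
have hB : ternary_code B <= ternary_sum B n + 3 / 2 * 3^-1 ^+ n.+1.
  apply: ge_sup; first by exists (ternary_sum B 0), 0%N.
  move=> _ [m _ <-]; have eqS : ternary_sum B n.+1 = ternary_sum B n.
    by rewrite /ternary_sum big_ord_recr /= asboolF// addr0.
  have [mn|/ltnW nm] := leqP m n.+1.
    rewrite (le_trans (ternary_sum_le B mn))// eqS lerDl.
    by rewrite mulr_ge0// exprn_ge0.
  have := ternary_sum_tail B nm; rewrite eqS.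
  have : 0 <= 3^-1 ^+ m :> R by rewrite exprn_ge0.
  lra.
apply: le_lt_trans hB (lt_le_trans _ hA); rewrite ltrD2l exprS.
have : 0 < 3^-1 ^+ n :> R by rewrite exprn_gt0.
lra.
Qed.

Lemma ternary_code_inj : injective ternary_code.
Proof.
move=> A B AB; apply/seteqP.
suff H n : A n <-> B n by split=> n /H.
elim/ltn_ind: n => n IH; apply: contrapT => nAB.
have [An|nA] := pselect (A n); have [Bn|nB] := pselect (B n).
- by apply: nAB.
- by have := ternary_code_lt IH An nB; rewrite AB ltxx.
- have IH' i : (i < n)%N -> B i <-> A i by move=> /IH; exact: iff_sym.
  by have := ternary_code_lt IH' Bn nA; rewrite AB ltxx.
- by apply: nAB.
Qed.

End ternary_code.

(** A double sequence is determined by the rational cuts of its entries, that is,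
by a subset of a countable set. *)
Lemma double_sequences_inject (R : realType) :
  exists code : (nat -> nat -> R) -> R, injective code.
Proof.
pose cut (F : nat -> nat -> R) : set nat :=
  [set c | exists n k (q : rat), c = choice.pickle (n, k, q) /\ ratr q < F n k].
exists (fun F => ternary_code R (cut F)) => F G /ternary_code_inj cutFG.
have half (F' G' : nat -> nat -> R) : cut F' = cut G' -> forall n k, F' n k <= G' n k.
  move=> cutE n k; rewrite leNgt; apply/negP => /rat_in_itvoo[q].
  rewrite in_itv/= => /andP[Gq qF].
  have : cut F' (choice.pickle (n, k, q)) by exists n, k, q.
  rewrite cutE => -[n' [k' [q' [/(pcan_inj choice.pickleK)[<- <- <-]]]]].
  by rewrite ltNge (ltW Gq).
apply/funext => n; apply/funext => k; apply/eqP; rewrite eq_le.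
by rewrite !half.
Qed.

(** * Common cluster values of finite tuples *)

Section shadowing.
Context (R : realType).
Implicit Types (F G : nat -> nat -> nat -> R) (y z : nat * nat).

Definition tuple_close F G (L : nat) (e : R) y z :=
  forall i, (i < L)%N -> `|F i y.1 y.2 - G i z.1 z.2| < e.

(** Every late point of [G] is approximated by arbitrarily late points of [F]: the
cluster values of [(G 0, ..., G (L - 1))] along the rows are cluster values of
[(F 0, ..., F (L - 1))], with the uniformity in [z] that compactness gives. *)
Definition shadows F G (L : nat) := forall e : R, 0 < e ->
  exists N, forall z, (N <= z.1)%N -> forall M, exists2 y, (M <= y.1)%N & tuple_close F G L e y z.

Definition bounded_rows (f : nat -> nat -> R) :=
  exists M : R, forall n k, `|f n k| <= M.

(** A bounded tuple has totally bounded range, cut here into finitely many boxes. *)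
Lemma finite_coloring F L (e : R) : (forall i, bounded_rows (F i)) -> 0 < e ->
  exists (T : finType) (c : nat * nat -> T),
    forall y z, c y = c z -> tuple_close F F L e y z.
Proof.
move=> bF e0; elim: L => [|L [T [c cP]]].
  by exists unit, (fun=> tt) => y z _ i.
have [M FM] := bF L.
pose q y := Num.truncn ((F L y.1 y.2 + M) / e).
pose K := Num.truncn ((M + M) / e).
have F0 y : 0 <= (F L y.1 y.2 + M) / e.
  rewrite divr_ge0 ?(ltW e0)//; have := FM y.1 y.2; rewrite ler_norml; lra.
have qK y : (q y < K.+1)%N.
  rewrite ltnS; apply: le_truncn; rewrite ler_pM2r ?invr_gt0// lerD2r.
  by have := FM y.1 y.2; rewrite ler_norml => /andP[].
exists (T * 'I_K.+1)%type, (fun y => (c y, Ordinal (qK y))) => y z [/cP cyz qyz] i.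
rewrite ltnS leq_eqVlt => /orP[/eqP ->|/cyz//].
have := truncn_itv (F0 y); have := truncn_itv (F0 z).
rewrite -/(q y) -/(q z) -qyz => /andP[h1 h2] /andP[h3 h4].
move: h1 h2 h3 h4; rewrite ler_pdivlMr// ltr_pdivrMr// ler_pdivlMr// ltr_pdivrMr//.
by rewrite -natr1 ltr_norml => *; apply/andP; split; lra.
Qed.

(** Boxes visited by finitely many rows only are left behind from some row on. *)
Lemma shadows_self F L : (forall i, bounded_rows (F i)) -> shadows F F L.
Proof.
move=> bF e e0; have [T [c cP]] := finite_coloring L bF e0.
pose late t M := exists2 y, (M <= y.1)%N & c y = t.
have /choice[N NP] : forall t, exists N, late t N -> forall M, late t M.
  move=> t; have [h|/existsNP[N hN]] := pselect (forall M, late t M).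
    by exists 0%N.
  by exists N.
exists (\max_t N t)%N => z zN M.
have [y My cy] : late (c z) M.
  by apply: NP; exists z => //; rewrite (leq_trans _ zN)// (leq_bigmax (c z)).
by exists y => //; exact: cP.
Qed.

Lemma shadows_reindex F G (j : nat -> nat) : (forall L, shadows F G L) ->
  forall L, shadows (fun i => F (j i)) (fun i => G (j i)) L.
Proof.
move=> FG L e e0; have [N NP] := FG (\max_(i < L) j i).+1 _ e0.
exists N => z /NP h M; have [y My yz] := h M; exists y => // i iL.
by apply: yz; rewrite ltnS (leq_bigmax (Ordinal iL)).
Qed.

End shadowing.

(** * Extending a correspondence by one family *)

Section one_point_extension.
Context (R : realType).
Implicit Types (F G : nat -> nat -> nat -> R) (y z : nat * nat).

(** [kappa m] retracts the rows onto representatives of the m-th partition of the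
underlying zero-dimensional space, and [E] is the space of continuous
functions: they are almost constant on the pieces of fine partitions, and every
bounded function that is constant on the pieces of a partition belongs to [E]. *)
Definition approximable (E : set (nat -> R)) (kappa : nat -> nat -> nat) :=
  (forall f, E f -> forall e : R, 0 < e ->
     exists m0, forall m, (m0 <= m)%N -> forall k, `|f k - f (kappa m k)| < e) /\
  (forall m h, (exists M : R, forall k, `|h k| <= M) -> E (h \o kappa m)).

Definition scons (T : Type) (x : T) (s : nat -> T) i :=
  if i is i'.+1 then s i' else x.

(** The exponent of 2 takes each value at arbitrarily large arguments. *)
Lemma recurrent_enumeration (T : countType) (x0 : T) :
  exists code : nat -> T, forall x M, exists2 j, (M <= j)%N & code j = x.
Proof.
exists (fun j => odflt x0 (choice.unpickle (logn 2 j))) => x M.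
exists (2 ^ choice.pickle x * M.*2.+1)%N.
  rewrite (leq_trans (_ : M <= M.*2.+1)%N)// ?leq_pmull ?expn_gt0//.
  by rewrite -addnn; lia.
rewrite lognM ?expn_gt0// pfactorK// lognE /= dvdn2 /= odd_double /= addn0.
by rewrite choice.pickleK.
Qed.

Lemma inv_succ_lt (e : R) : 0 < e ->
  exists j0, forall j, (j0 <= j)%N -> j.+1%:R^-1 < e.
Proof.
move=> e0; exists (Num.bound e^-1) => j hj.
rewrite -(invrK e) ltf_pV2 ?posrE ?invr_gt0// (lt_le_trans (archi_boundP _))//.
  by rewrite invr_ge0 ltW.
by rewrite ler_nat ltnW.
Qed.

Lemma uniform_approximation E kappa G n L (e : R) :
  approximable E kappa -> (forall i, E (G i n)) -> 0 < e ->
  exists m, forall i k, (i < L)%N -> `|G i n k - G i n (kappa m k)| < e.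
Proof.
move=> [appE _] GE e0.
have /choice[m mP] := fun i => appE _ (GE i) e e0.
exists (\max_(i < L) m i)%N => i k iL.
by apply: mP; rewrite (leq_bigmax (Ordinal iL)).
Qed.

(** The countable saturation behind the back-and-forth. The rows are cut into
consecutive blocks. In block [j] the tuple [(G 0, ..., G (j - 1))] is shadowed by
the corresponding tuple of [F] within [e j], so copying values of [f] from
shadowing points makes every late point of the extended [G] shadowed by the
extended [F]. One row of each block is moreover devoted to one point of the
extended [F] that has to be reached by the extended [G]; each such point is
considered in infinitely many blocks. *)
Lemma one_point_extension F G (f : nat -> nat -> R) E kappa :
  approximable E kappa -> (forall i, bounded_rows (F i)) ->
  (forall i n, E (G i n)) ->
  (forall L, shadows F G L) -> (forall L, shadows G F L) -> bounded_rows f ->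
  exists g, [/\ bounded_rows g, forall n, E (g n),
    forall L, shadows (scons f F) (scons g G) L &
    forall L, shadows (scons g G) (scons f F) L].
Proof.
move=> appE bF GE FG GF bf.
pose e j : R := j.+1%:R^-1.
have e_gt0 j : 0 < e j by rewrite invr_gt0.
have e_le i j : (i <= j)%N -> e j <= e i.
  by move=> ij; rewrite lef_pV2 ?posrE// ler_nat.
pose F' := scons f F.
have bF' i : bounded_rows (F' i) by case: i.
have /choice[a aP] := fun j => FG j (e j) (e_gt0 j).
have /choice[b bP] := fun j => GF j (e j) (e_gt0 j).
have [code codeP] := @recurrent_enumeration (nat * (nat * nat))%type (0, (0, 0))%N.
(* The task of block j is to reach the point (code j).2 with the precision given
   by (code j).1. If later points approximate it, its place is taken by such a point
   t j, so that the precision of the block itself can be respected as well. *)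
pose target j y' := (forall M, exists2 y'', (M <= y''.1)%N &
    tuple_close F' F' (code j).1 (e (code j).1) y'' (code j).2) ->
  tuple_close F' F' (code j).1 (e (code j).1) y' (code j).2.
have /choice[t tP] : forall j, exists y', (maxn (b j) j <= y'.1)%N /\ target j y'.
  move=> j; have [h|nh] := pselect (forall M, exists2 y'', (M <= y''.1)%N &
      tuple_close F' F' (code j).1 (e (code j).1) y'' (code j).2).
    by have [y' h1 h2] := h (maxn (b j) j); exists y'; split.
  by exists (maxn (b j) j, 0%N); split.
have /choice[z zP] : forall jN : nat * nat, exists z, (jN.2 <= z.1)%N /\
    tuple_close G F jN.1 (e jN.1) z (t jN.1).
  move=> [j N] /=; have [] := tP j; rewrite geq_max => /andP[bj _] _.
  by have [z h1 h2] := bP j _ bj N; exists z; split.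
(* Block j starts at N j and contains the row of the point w j, at which the
   value of f at t j is going to be copied. *)
pose N := fix N j := if j is j'.+1 then maxn (a j) (z (j', N j')).1.+1 else a 0%N.
pose w j := z (j, N j).
have aN j : (a j <= N j)%N by case: j => [|j] //=; rewrite leq_maxl.
have Nw j : (N j <= (w j).1)%N by have [] := zP (j, N j).
have wN j : ((w j).1 < N j.+1)%N by rewrite /= leq_maxr.
have N_homo i j : (i <= j)%N -> (N i <= N j)%N.
  elim: j => [|j IH]; first by rewrite leqn0 => /eqP ->.
  rewrite leq_eqVlt => /orP[/eqP -> //|]; rewrite ltnS => /IH h.
  exact: leq_trans h (leq_trans (Nw j) (ltnW (wN j))).
have leN j : (j <= N j)%N.
  by elim: j => // j IH; exact: leq_ltn_trans IH (leq_ltn_trans (Nw j) (wN j)).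
pose block j n := (N j <= n < N j.+1)%N.
have block_uniq i j n : block i n -> block j n -> i = j.
  move=> /andP[h1 h2] /andP[h3 h4]; apply/eqP; rewrite eqn_leq.
  apply/andP; split; rewrite leqNgt; apply/negP => /N_homo h.
    by have := leq_trans (leq_ltn_trans h1 h4) h; rewrite ltnn.
  by have := leq_trans (leq_ltn_trans h3 h2) h; rewrite ltnn.
have find_block J n : (N J <= n)%N -> exists2 j, (J <= j)%N & block j n.
  move=> Jn; have ex : exists j, (n < N j.+1)%N by exists n; exact: leN.
  case: (ex_minnP ex) => j jn jmin.
  have Jj : (J <= j)%N.
    rewrite leqNgt; apply/negP => /N_homo h.
    by have := leq_trans jn (leq_trans h Jn); rewrite ltnn.
  exists j => //; rewrite /block jn andbT.
  case: j jn jmin Jj => [|j] jn jmin; first by rewrite leqn0 => /eqP J0; rewrite -J0.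
  by move=> _; rewrite leqNgt; apply/negP => /jmin; rewrite ltnn.
have [Mf fM] := bf.
have rowP n : exists r, [/\ E r, forall k, `|r k| <= Mf & forall j, block j n ->
    (forall k, exists y, [/\ (j <= y.1)%N,
       forall i, (i < j)%N -> `|F i y.1 y.2 - G i n k| < 3 * e j &
       r k = f y.1 y.2]) /\
    (n = (w j).1 -> r (w j).2 = f (t j).1 (t j).2)].
  have [[j jn]|nj] := pselect (exists j, block j n); last first.
    exists ((fun=> 0) \o kappa 0%N); split.
    - by apply appE.2; exists 0 => k; rewrite normr0.
    - by move=> k /=; rewrite normr0 (le_trans (normr_ge0 _) (fM 0%N 0%N)).
    - by move=> j jn; case: nj; exists j.
  have [m mP] := @uniform_approximation E kappa G n j _ appE (fun i => GE i n) (e_gt0 j).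
  have /choice[y yP] : forall k, exists y, (j <= y.1)%N /\ tuple_close F G j (e j) y (n, k).
    move=> k; have [|y h1 h2] := aP j (n, k) _ j; last by exists y.
    by rewrite (leq_trans (aN j))//; case/andP: jn.
  (* The piece of w j is reserved for the task of the block, the other pieces
     copy a shadowing point. *)
  pose special k := (n == (w j).1) && (k == kappa m (w j).2).
  pose p k := if special k then t j else y k.
  exists ((fun k => f (p k).1 (p k).2) \o kappa m); split.
  - by apply appE.2; exists Mf.
  - by move=> k /=.
  move=> j' /(block_uniq _ _ _ jn) <-; split=> [k|nw]; last first.
    by rewrite /= /p /special -nw !eqxx.
  exists (p (kappa m k)); split=> //.
    rewrite /p; case: ifP => _; last by have [] := yP (kappa m k).
    by have [] := tP j; rewrite geq_max => /andP[].
  move=> i ij; have := mP i k ij; rewrite /p; case: ifP => [/andP[/eqP nw /eqP kw]|_].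
    have := mP i (w j).2 ij; have [_ /(_ i ij)] := zP (j, N j).
    rewrite -/(w j) /= -nw kw !ltr_norml => /andP[? ?] /andP[? ?] /andP[? ?].
    by apply/andP; split; lra.
  have [_ /(_ i ij) /=] := yP (kappa m k).
  have := e_gt0 j.
  rewrite !ltr_norml => ? /andP[? ?] /andP[? ?].
  by apply/andP; split; lra.
have /choice[g gP] := rowP.
exists g; split.
- by exists Mf => n k; have [] := gP n.
- by move=> n; have [] := gP n.
- move=> L eps eps0.
  have eps6 : 0 < eps / 6 by lra.
  have eps2 : 0 < eps / 2 by lra.
  have [j0 j0P] := inv_succ_lt eps6.
  (* The copied point only lies in some row beyond j; the same values recur in
     arbitrarily late rows. *)
  have [N1 N1P] := shadows_self L bF' eps2.
  exists (N (maxn j0 (maxn L N1))) => x /find_block[j].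
  rewrite !geq_max => /and3P[j0j Lj N1j] jx M.
  have [_ _ /(_ j jx)[/(_ x.2)[y [jy yP yE]] _]] := gP x.1.
  have [y' My' y'y] := N1P y (leq_trans N1j jy) M.
  exists y' => // i iL; have := y'y i iL; have := j0P j j0j.
  rewrite -/(e j); case: i iL => [|i] iL /=; first by rewrite yE => *; lra.
  have := yP i (leq_trans (ltnW iL) Lj).
  rewrite !ltr_norml => /andP[? ?] ? /andP[? ?].
  by apply/andP; split; lra.
- move=> L eps eps0.
  have eps2 : 0 < eps / 2 by lra.
  have [j0 j0P] := inv_succ_lt eps2.
  pose L1 := maxn L j0.
  have [N1 N1P] := shadows_self L1 bF' (e_gt0 L1).
  exists N1 => y N1y M.
  have [j jM jE] := codeP (L1, y) (maxn M L1); rewrite geq_max in jM.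
  have /andP[Mj L1j] := jM.
  have ty : tuple_close F' F' L1 (e L1) (t j) y.
    have [_ ] := tP j; rewrite /target jE /=; apply => M'.
    exact: N1P.
  exists (w j); first by rewrite (leq_trans Mj)// (leq_trans (leN j)).
  have [_ _ /(_ j)[|_ /(_ erefl) gw]] := gP (w j).1.
    by rewrite /block Nw wN.
  have eL1 : e L1 < eps / 2 by apply: j0P; rewrite leq_maxr.
  move=> i iL; have := ty i (leq_trans iL (leq_maxl _ _)).
  case: i iL => [|i] iL /=; first by rewrite gw => *; lra.
  have ij : (i < j)%N by rewrite (leq_trans (ltnW iL))// (leq_trans _ L1j)// leq_maxl.
  have [_ /(_ i ij) /=] := zP (j, N j); rewrite -/(w j).
  have := e_le _ _ L1j.
  rewrite !ltr_norml => ? /andP[? ?] /andP[? ?].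
  by apply/andP; split; lra.
Qed.
End one_point_extension.

(** * Isomorphic reduced powers *)

Section matching.
Context (R : realType).
Implicit Types (E : set (nat -> R)) (p : nat -> (nat -> nat -> R) * (nat -> nat -> R)).

Definition families E : set (nat -> nat -> R) :=
  [set F | bounded_rows F /\ forall n, E (F n)].

(** Both shadowing conditions together say that the two tuples have the same set of
cluster values, so that every closed condition that holds asymptotically for one
of them holds for the other. *)
Definition indiscernible E E' L p :=
  [/\ forall i, (i < L)%N -> families E (p i).1 /\ families E' (p i).2,
      shadows (fst \o p) (snd \o p) L & shadows (snd \o p) (fst \o p) L].

Lemma indiscernible_swap E E' L p :
  indiscernible E E' L p -> indiscernible E' E L (@swap_pair _ _ \o p).
Proof. by move=> [pE h1 h2]; split => // i /pE[]. Qed.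

Lemma indiscernible_range E E' p : (forall L, indiscernible E E' L p) ->
  finitely_good (indiscernible E E') (range p).
Proof.
move=> sp L q qp.
have /choice[j jP] : forall i, exists j, (i < L)%N -> p j = q i.
  move=> i; have [/qp[j _ jq]|_] := ltnP i L; first by exists j.
  by exists 0%N.
have sj M : shadows (fun i => (p (j i)).1) (fun i => (p (j i)).2) M.
  by apply: (@shadows_reindex _ (fst \o p) (snd \o p)) => L'; have [] := sp L'.
have sj' M : shadows (fun i => (p (j i)).2) (fun i => (p (j i)).1) M.
  by apply: (@shadows_reindex _ (snd \o p) (fst \o p)) => L'; have [] := sp L'.
split=> [i iL|e e0|e e0].
- by rewrite -jP//; have [/(_ _ (ltnSn (j i)))] := sp (j i).+1.
- have [N NP] := sj L e e0; exists N => z /NP h M; have [y My yz] := h M.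
  by exists y => // i iL; rewrite /= -jP//; exact: yz.
- have [N NP] := sj' L e e0; exists N => z /NP h M; have [y My yz] := h M.
  by exists y => // i iL; rewrite /= -jP//; exact: yz.
Qed.

Lemma families0 E kappa : approximable E kappa -> families E (fun _ _ => 0).
Proof.
move=> [_ simpleE]; split; first by exists 0 => n k; rewrite normr0.
by move=> n; apply: (simpleE 0%N (fun=> 0)); exists 0 => k; rewrite normr0.
Qed.

Lemma indiscernible_extend E E' kappa' p F :
  approximable E' kappa' -> (forall L, indiscernible E E' L p) -> families E F ->
  exists G, forall L, indiscernible E E' L (scons (F, G) p).
Proof.
move=> appE' sp [bF EF].
have pE i : families E (p i).1 /\ families E' (p i).2.
  by have [/(_ _ (ltnSn i))] := sp i.+1.
have [G [bG EG FG GF]] := @one_point_extension _ (fst \o p) (snd \o p) F _ _ appE'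
  (fun i => (pE i).1.1) (fun i => (pE i).2.2)
  (fun L => let: And3 _ h _ := sp L in h) (fun L => let: And3 _ _ h := sp L in h) bF.
have E1 : fst \o scons (F, G) p = scons F (fst \o p) by apply/funext => -[].
have E2 : snd \o scons (F, G) p = scons G (snd \o p) by apply/funext => -[].
by exists G => L; split; rewrite ?E1 ?E2// => -[|i] _ //=; exact: pE.
Qed.

Lemma indiscernible_enumerate E E' kappa kappa' rho :
  approximable E kappa -> approximable E' kappa' ->
  countable rho -> finitely_good (indiscernible E E') rho ->
  exists2 p, rho `<=` range p & forall L, indiscernible E E' L p.
Proof.
move=> aE aE' crho grho; have [->|/set0P[t rhot]] := eqVneq rho set0.
  (* An empty relation is enumerated by the pair of zero families. *)
  exists (fun=> (fun _ _ => 0, fun _ _ => 0)) => // L.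
  split=> [i _|e e0|e e0]; first by split; [exact: families0 aE|exact: families0 aE'].
  - by exists 0%N => z _ M; exists (M, 0%N) => // i _ /=; rewrite subrr normr0.
  - by exists 0%N => z _ M; exists (M, 0%N) => // i _ /=; rewrite subrr normr0.
have [p pE] : exists p : nat -> _, rho = range p.
  have /countable_injP[h hinj] := crho.
  have /choice[p pP] : forall n, exists s, rho s /\ forall s', rho s' -> h s' = n -> s' = s.
    move=> n; have [[s [rs hs]]|ns] := pselect (exists s, rho s /\ h s = n).
      exists s; split => // s' rs' hs'; apply: hinj; rewrite ?inE//; congruence.
    by exists t; split => // s' rs' hs'; case: ns; exists s'.
  exists p; apply/seteqP; split=> [s rs|_ [n _ <-]]; last exact: (pP n).1.
  by exists (h s) => //; rewrite -((pP (h s)).2 s).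
exists p => [|L]; first by rewrite pE.
by apply: grho => i _; rewrite pE; exists i.
Qed.

(** Back and forth: each double sequence is treated once as an element of the first
space and once as an element of the second one. *)
Lemma matching_exists E E' kappa kappa' : continuum_hypothesis R ->
  approximable E kappa -> approximable E' kappa' ->
  exists rho, [/\ finitely_good (indiscernible E E') rho,
    forall F, families E F -> exists G, rho (F, G) &
    forall G, families E' G -> exists F, rho (F, G)].
Proof.
move=> CH aE aE'; have [code code_inj] := double_sequences_inject R.
pose covers H (rho : set ((nat -> nat -> R) * (nat -> nat -> R))) :=
  (families E H -> exists G, rho (H, G)) /\ (families E' H -> exists F, rho (F, H)).
have [| | |rho grho rhoC] := @transfinite_exhaustion R _ _ code
    (indiscernible E E') covers CH code_inj.
- move=> [|L] p pS; last by have := pS 0%N isT.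
  split=> [//|e e0|e e0]; exists 0%N => z _ M.
  + by exists (M, 0%N).
  + by exists (M, 0%N).
- move=> H rho rho' sub [h1 h2].
  by split=> [/h1[G]|/h2[F]] /sub ?; [exists G|exists F].
- move=> rho H crho grho.
  have [p0 rp0 sp0] := indiscernible_enumerate aE aE' crho grho.
  have [p1 [rp1 sp1 c1]] : exists p1, [/\ range p0 `<=` range p1,
      forall L, indiscernible E E' L p1 & families E H -> exists G, range p1 (H, G)].
    have [EH|nEH] := pselect (families E H); last by exists p0; split.
    have [G sG] := indiscernible_extend aE' sp0 EH; exists (scons (H, G) p0); split => //.
      by move=> _ [n _ <-]; exists n.+1.
    by exists G, 0%N.
  have [p2 [rp2 sp2 c2]] : exists p2, [/\ range p1 `<=` range p2,
      forall L, indiscernible E E' L p2 & families E' H -> exists F, range p2 (F, H)].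
    have [EH|nEH] := pselect (families E' H); last by exists p1; split.
    have [F sF] := indiscernible_extend aE (fun L => indiscernible_swap (sp1 L)) EH.
    exists (scons (F, H) p1); split => //.
    + by move=> _ [n _ <-]; exists n.+1.
    + move=> L; have := indiscernible_swap (sF L); congr indiscernible.
      by apply/funext => -[|i] //=; case: (p1 i).
    + by exists F, 0%N.
  exists (range p2); split.
  + by apply: subset_trans rp0 _; apply: subset_trans rp1 _.
  + by apply: card_image_le.
  + exact: indiscernible_range.
  + by split => // /c1[G /rp2 ?]; exists G.
by exists rho; split => // F; have [] := rhoC F.
Qed.

End matching.

(** * Two isomorphic spaces of rows *)

Section row_spaces.
Context (R : realType).
Implicit Types (f g b d : nat -> R).

Definition constant_rows : set (nat -> R) := [set f | forall k, f k = f 0%N].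

Definition dyadic_rows : set (nat -> R) :=
  [set g | forall e : R, 0 < e -> exists m, forall k k', (k = k' %[mod 2 ^ m])%N ->
    `|g k - g k'| < e].

Definition vanishing b :=
  forall e : R, 0 < e -> exists K, forall k, (K <= k)%N -> `|b k| < e.

Definition dyadic_plus_null_rows : set (nat -> R) :=
  [set f | exists g b, [/\ dyadic_rows g, vanishing b & f = (fun k => g k + b k)]].

Lemma constant_rows_approximable : approximable constant_rows (fun _ _ => 0%N).
Proof.
split=> [f fc e e0|m h _ k //].
by exists 0%N => m _ k; rewrite fc subrr normr0.
Qed.

Lemma modn_exp2 k i m : (i <= m)%N -> (k %% 2 ^ m = k %[mod 2 ^ i])%N.
Proof. by move=> im; rewrite modn_dvdm// dvdn_exp2l. Qed.

Lemma dyadic_rows_approximable : approximable dyadic_rows (fun m k => k %% 2 ^ m)%N.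
Proof.
split=> [g gE e /gE[m0 m0P]|m h _ e e0].
  by exists m0 => m m0m k; apply: m0P; rewrite modn_exp2.
by exists m => k k' /= ->; rewrite subrr normr0.
Qed.

(** The m-th partition of the naturals: the numbers below [2 ^ m] are singletons,
the other ones are sorted by their residue modulo [2 ^ m]. Adding [2 ^ m] to the
residue keeps the representative of the class among the large numbers. *)
Definition isolate m k := (if k < 2 ^ m then k else 2 ^ m + k %% 2 ^ m)%N.

Lemma dyadic_plus_null_rows_approximable : approximable dyadic_plus_null_rows isolate.
Proof.
split=> [_ [g [b [gE b0 ->]]] e e0|m h [M hM]].
  have e20 : 0 < e / 3 by lra.
  have [m1 m1P] := gE _ e20; have [K KP] := b0 _ e20.
  exists (maxn m1 K) => m; rewrite geq_max => /andP[m1m Km] k; rewrite /isolate.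
  case: ltnP => [_|mk]; first by rewrite subrr normr0.
  have Kk i : (2 ^ m <= i)%N -> `|b i| < e / 3.
    have m2 : (m <= 2 ^ m)%N by rewrite ltnW// ltn_expl.
    by move=> mi; apply: KP; rewrite (leq_trans (leq_trans Km m2) mi).
  have := Kk _ mk; have := Kk _ (leq_addr (k %% 2 ^ m) (2 ^ m)).
  have : `|g k - g (2 ^ m + k %% 2 ^ m)%N| < e / 3.
    by apply: m1P; rewrite -modnDmr modn_exp2// modnDmr -modnDml (eqP (dvdn_exp2l 2 m1m)).
  rewrite !ltr_norml => /andP[? ?] /andP[? ?] /andP[? ?].
  by apply/andP; split; lra.
pose g k := h (2 ^ m + k %% 2 ^ m)%N.
exists g, (fun k => if (k < 2 ^ m)%N then h k - g k else 0); split.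
- by move=> e e0; exists m => k k' kk'; rewrite /g kk' subrr normr0.
- move=> e e0; exists (2 ^ m)%N => k; rewrite leqNgt => /negbTE ->.
  by rewrite normr0.
- apply/funext => k; rewrite /= /isolate; case: ifP => _; first by rewrite addrC subrK.
  by rewrite addr0.
Qed.

Lemma dyadic_rowsD g g' : dyadic_rows g -> dyadic_rows g' ->
  dyadic_rows (fun k => g k + g' k).
Proof.
move=> gE gE' e e0; have e20 : 0 < e / 2 by lra.
have [m mP] := gE _ e20; have [m' mP'] := gE' _ e20.
exists (maxn m m') => k k' kk'.
have kkm i : (i <= maxn m m')%N -> (k = k' %[mod 2 ^ i])%N.
  by move=> im; rewrite -(modn_exp2 k im) kk' modn_exp2.
have := mP _ _ (kkm _ (leq_maxl _ _)); have := mP' _ _ (kkm _ (leq_maxr _ _)).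
rewrite !ltr_norml => /andP[? ?] /andP[? ?].
by apply/andP; split; lra.
Qed.

Lemma logn2_mod m k k' : (k = k' %[mod 2 ^ m])%N -> ~~ (2 ^ m %| k)%N ->
  [/\ (k != 0)%N, (k' != 0)%N & logn 2 k = logn 2 k'].
Proof.
have half i j : (i = j %[mod 2 ^ m])%N -> ~~ (2 ^ m %| i)%N -> ~~ (2 ^ m %| j)%N ->
    (logn 2 i <= logn 2 j)%N.
  move=> ij ni nj; have [i0 j0] : (0 < i)%N /\ (0 < j)%N.
    by split; rewrite lt0n; [move: ni|move: nj]; apply: contra => /eqP ->; rewrite dvdn0.
  have im : (logn 2 i <= m)%N.
    by apply: ltnW; rewrite ltnNge; apply: contra ni; rewrite pfactor_dvdn.
  rewrite -pfactor_dvdn// /dvdn -(modn_exp2 j im) -ij modn_exp2//.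
  by rewrite -/(dvdn _ _) pfactor_dvdn.
move=> kk' nk; have nk' : ~~ (2 ^ m %| k')%N by rewrite /dvdn -kk'.
split; [move: nk|move: nk'|]; try by apply: contra => /eqP ->; rewrite dvdn0.
by apply/eqP; rewrite eqn_leq !half.
Qed.

(** The function is constant on the spheres around 0, and its oscillation on balls
around 0 tends to 0. *)
Lemma dyadic_rows_level d : vanishing d ->
  dyadic_rows (fun k => if k == 0%N then 0 else d (logn 2 k)).
Proof.
move=> d0 e e0; have e20 : 0 < e / 2 by lra.
have [m mP] := d0 _ e20; exists m => k k' kk'.
have [mk|mk] := boolP (2 ^ m %| k)%N; last first.
  have [/negbTE -> /negbTE -> ->] := logn2_mod kk' mk.
  by rewrite subrr normr0.
have small i : (2 ^ m %| i)%N -> `|if i == 0%N then 0 else d (logn 2 i)| < e / 2.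
  have [_|i0 mi] := eqVneq i 0%N; first by rewrite normr0.
  by apply: mP; rewrite -pfactor_dvdn// lt0n.
have mk' : (2 ^ m %| k')%N by rewrite /dvdn -kk'.
have := small _ mk; have := small _ mk'.
rewrite !ltr_norml => /andP[? ?] /andP[? ?].
by apply/andP; split; lra.
Qed.

Lemma dyadic_rows_pow2 g : dyadic_rows g -> vanishing (fun n => g (2 ^ n)%N - g 0%N).
Proof.
move=> gE e /gE[m mP]; exists m => n mn; apply: mP.
by rewrite mod0n; apply/eqP; exact: dvdn_exp2l.
Qed.

Lemma vanishing_comp d (h : nat -> nat) : vanishing d -> (forall n, (n <= h n)%N) ->
  vanishing (d \o h).
Proof.
by move=> d0 hn e /d0[K KP]; exists K => k Kk; apply: KP; exact: leq_trans (hn k).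
Qed.

Lemma vanishingB d d' : vanishing d -> vanishing d' -> vanishing (fun n => d n - d' n).
Proof.
move=> d0 d0' e e0; have e20 : 0 < e / 2 by lra.
have [K KP] := d0 _ e20; have [K' KP'] := d0' _ e20; exists (maxn K K') => k.
rewrite geq_max => /andP[/KP + /KP'].
rewrite !ltr_norml => /andP[? ?] /andP[? ?].
by apply/andP; split; lra.
Qed.

(** A number has arbitrarily large 2-adic approximations, at which [b] is negligible. *)
Lemma dyadic_part_le g b M : dyadic_rows g -> vanishing b ->
  (forall k, `|g k + b k| <= M) -> forall k, `|g k| <= M.
Proof.
move=> gE b0 fM k; apply/ler_addgt0Pr => e e0; have e20 : 0 < e / 2 by lra.
have [m mP] := gE _ e20; have [K KP] := b0 _ e20.
have := mP k (k + K * 2 ^ m)%N; rewrite addnC modnMDl => /(_ erefl).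
have := KP (K * 2 ^ m + k)%N.
rewrite (leq_trans (leq_pmulr K (expn_gt0 2 m)) (leq_addr _ _)) => /(_ isT).
have := fM (K * 2 ^ m + k)%N.
rewrite !ltr_norml !ler_norml => /andP[? ?] /andP[? ?] /andP[? ?].
by apply/andP; split; lra.
Qed.

(** Put [a n := g (2 ^ n) - g 0], a null sequence. The first summand replaces [a n] by
[a (2 n)] on the sphere [logn 2 k = n], and the second one is the null sequence
of the remaining coordinates [a (2 k + 1)]. This is the isomorphism
[c0 ~ c0 + c0] that splits even and odd coordinates, read on the copy of [c0]
inside [dyadic_rows]. *)
Definition shuffle g k :=
  (g k + if k == 0%N then 0 else g (2 ^ (logn 2 k).*2)%N - g (2 ^ logn 2 k)%N) +
  (g (2 ^ k.*2.+1)%N - g 0%N).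

Lemma shuffle_decomposition g : dyadic_rows g ->
  dyadic_rows (fun k => g k + if k == 0%N then 0
                 else g (2 ^ (logn 2 k).*2)%N - g (2 ^ logn 2 k)%N) /\
  vanishing (fun k => g (2 ^ k.*2.+1)%N - g 0%N).
Proof.
move=> gE; have p0 := dyadic_rows_pow2 gE; split.
  apply: dyadic_rowsD => //.
  apply: (dyadic_rows_level (d := fun n => g (2 ^ n.*2)%N - g (2 ^ n)%N)).
  have := vanishingB (vanishing_comp p0 (h := double) _) p0.
  have dbl n : (n <= n.*2)%N by rewrite -addnn leq_addr.
  move=> /(_ dbl) h e /h[K KP]; exists K => k /KP /=.
  by rewrite opprB addrA subrK.
apply: (vanishing_comp p0 (h := fun k => k.*2.+1)) => n.
by rewrite -addnn -addnS leq_addr.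
Qed.

Lemma shuffle_rows g : dyadic_rows g -> dyadic_plus_null_rows (shuffle g).
Proof.
move=> /shuffle_decomposition[h1 h2].
by exists (fun k => g k + if k == 0%N then 0
                    else g (2 ^ (logn 2 k).*2)%N - g (2 ^ logn 2 k)%N),
          (fun k => g (2 ^ k.*2.+1)%N - g 0%N); split.
Qed.

Lemma shuffle_le g M : (forall k, `|g k| <= M) -> forall k, `|shuffle g k| <= 5 * M.
Proof.
move=> gM k; rewrite /shuffle.
have := gM k; have := gM (2 ^ (logn 2 k).*2)%N; have := gM (2 ^ (logn 2 k))%N.
have := gM (2 ^ k.*2.+1)%N; have := gM 0%N.
rewrite !ler_norml => /andP[? ?] /andP[? ?] /andP[? ?] /andP[? ?] /andP[? ?].
by case: ifP => _; apply/andP; split; lra.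
Qed.

Lemma shuffle_ge g M : dyadic_rows g ->
  (forall k, `|shuffle g k| <= M) -> forall k, `|g k| <= 5 * M.
Proof.
move=> gE SM.
have [hE b0] := shuffle_decomposition gE.
have hM := dyadic_part_le hE b0 SM.
have oddM n : `|g (2 ^ n.*2.+1)%N - g 0%N| <= 2 * M.
  have := hM n; have := SM n; rewrite /shuffle !ler_norml => /andP[? ?] /andP[? ?].
  by apply/andP; split; lra.
have evenM n : `|g (2 ^ n.*2)%N - g 0%N| <= 2 * M.
  have := hM 0%N; have := hM (2 ^ n)%N; rewrite eqxx expn_eq0 /= pfactorK// addr0.
  rewrite !ler_norml => /andP[? ?] /andP[? ?].
  by apply/andP; split; lra.
have powM n : `|g (2 ^ n)%N - g 0%N| <= 2 * M.
  by rewrite -(odd_double_half n); case: (odd n); rewrite ?add1n ?add0n.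
move=> k; have := hM k; have := powM (logn 2 k); have := evenM (logn 2 k).
rewrite !ler_norml => /andP[? ?] /andP[? ?].
by case: ifP => _ /andP[? ?]; apply/andP; split; lra.
Qed.

(** Here [c] and [b] are the even and odd coordinates, [A] interleaves them. *)
Lemma shuffle_onto f : dyadic_plus_null_rows f -> exists2 g, dyadic_rows g & shuffle g = f.
Proof.
move=> [h [b [hE b0 fE]]].
pose c n := h (2 ^ n)%N - h 0%N.
pose A n := if odd n then b n./2 else c n./2.
have c0 : vanishing c by exact: dyadic_rows_pow2.
have A0 : vanishing A.
  move=> e e0; have [K KP] := c0 _ e0; have [K' KP'] := b0 _ e0.
  exists (maxn K K').*2 => n; rewrite -geq_half_double geq_max => /andP[n1 n2].
  by rewrite /A; case: ifP => _; [exact: KP'|exact: KP].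
pose g k := h k + if k == 0%N then 0 else A (logn 2 k) - c (logn 2 k).
have gE : dyadic_rows g.
  apply: dyadic_rowsD => //.
  by apply: (dyadic_rows_level (d := fun n => A n - c n)); exact: vanishingB.
have g0 : g 0%N = h 0%N by rewrite /g eqxx addr0.
have g2 n : g (2 ^ n)%N = h 0%N + A n.
  by rewrite /g expn_eq0 /= pfactorK// /c; lra.
have A_even n : A n.*2 = c n by rewrite /A odd_double doubleK.
have A_odd n : A n.*2.+1 = b n by rewrite /A /= odd_double /= uphalf_double.
exists g => //; apply/funext => k; rewrite /shuffle !g2 g0 fE A_even A_odd /g.
by case: ifP => _; lra.
Qed.

Lemma shuffle_linear a g g' :
  shuffle (fun k => a * g k + g' k) = (fun k => a * shuffle g k + shuffle g' k).
Proof. by apply/funext => k; rewrite /shuffle; case: ifP => _; lra. Qed.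

End row_spaces.

(** * Norms modulo null sequences *)

Lemma finite_natP (A : set nat) :
  finite_set A <-> exists N, forall n, (N <= n)%N -> ~ A n.
Proof.
split=> [/finite_seqP[s ->]|[N NA]].
  exists (\max_(i <- s) i).+1 => n nN /= ns.
  by have := leq_trans nN (@leq_bigmax_seq _ s xpredT id n ns isT); rewrite ltnn.
apply: (@sub_finite_set _ _ `I_N) => [n An /=|]; last exact: finite_II.
by rewrite ltnNge; apply/negP => /NA.
Qed.

Lemma infinite_natP (A : set nat) :
  infinite_set A <-> forall N, exists2 n, (N <= n)%N & A n.
Proof.
split=> [infA N|h /finite_natP[N NA]]; last by have [n /NA] := h N.
apply: contrapT => nex; apply: infA; apply/finite_natP; exists N => n Nn An.
by apply: nex; exists n.
Qed.

Section tails.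
Context (R : realType).
Implicit Types F G : nat -> nat -> R.

(** The essential bound: the norm of [F] modulo families tending to 0 is at most [M].
For [M = 0] it says that [F] tends to 0. *)
Definition tail_le F (M : R) := forall e : R, 0 < e ->
  exists N, forall n k, (N <= n)%N -> `|F n k| <= M + e.

Lemma tail_le_shadows (F G : nat -> nat -> nat -> R) L (a : nat -> R) M :
  shadows F G L -> tail_le (fun n k => \sum_(i < L) a i * F i n k) M ->
  tail_le (fun n k => \sum_(i < L) a i * G i n k) M.
Proof.
move=> FG FM e e0; have e20 : 0 < e / 2 by lra.
have [N1 N1P] := FM _ e20.
pose C := \sum_(i < L) `|a i| + 1.
have C0 : 0 < C by rewrite ltr_wpDl// sumr_ge0.
have [N NP] := FG (e / 2 / C) (divr_gt0 e20 C0); exists N => n k Nn.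
have [y N1y yz] := NP (n, k) Nn N1.
have -> : \sum_(i < L) a i * G i n k = \sum_(i < L) a i * F i y.1 y.2 +
    \sum_(i < L) a i * (G i n k - F i y.1 y.2).
  by rewrite -big_split /=; apply: eq_bigr => i _; rewrite -mulrDr addrC subrK.
rewrite (le_trans (ler_normD _ _))// [e in leRHS]splitr addrA lerD// ?N1P//.
rewrite (le_trans (ler_norm_sum _ _ _))//.
apply: (@le_trans _ _ (\sum_(i < L) `|a i| * (e / 2 / C))).
  apply: ler_sum => i _; rewrite normrM ler_wpM2l// distrC ltW//.
  exact: (yz i (ltn_ord i)).
rewrite -mulr_suml mulrA ler_pdivrMr// mulrC ler_wpM2l ?(ltW e20)//.
by rewrite lerDl.
Qed.

Definition constant_family (f : linf R nat) : nat -> nat -> R :=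
  fun n _ => linf_fun f n.

Lemma families_constantP F :
  families (@constant_rows R) F <-> exists f, F = constant_family f.
Proof.
split=> [[[M FM] cF]|[f ->]].
  have fb : ((fun n => F n 0%N) : nat -> R^o) \in @linf_pred R nat.
    by apply/linf_predP; exists M.
  by exists (Linf fb); apply/funext => n; apply/funext => j; exact: (cF n j).
split; last by [].
by have /linf_predP[M fM] := valP f; exists M => n k; exact: fM.
Qed.

Lemma c0_tailP (f : linf R nat) :
  f \in @c0_pred R nat <-> tail_le (constant_family f) 0.
Proof.
split=> [/c0_predP h e /h/finite_natP[N NP]|h].
  by exists N => n k /NP/negP; rewrite -ltNge add0r => /ltW.
apply/c0_predP => e e0; apply/finite_natP.
have e20 : 0 < e / 2 by lra.
have [N NP] := h _ e20; exists N => n /(NP n 0%N); rewrite /constant_family /= => h1 h2.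
lra.
Qed.

Lemma norm_tailP (f : linf R nat) M :
  `|\pi_(linf_c0 R nat) f| <= M <-> tail_le (constant_family f) M.
Proof.
split=> [fM e e0|fM].
  have e20 : 0 < e / 2 by lra.
  have /quot_norm_lt[g gf gM] : quot_norm (\pi_(linf_c0 R nat) f) < M + e / 2.
    by rewrite (le_lt_trans fM)// ltrDl.
  have /eq_linf_c0/c0_tailP/(_ _ e20)[N NP] := gf.
  exists N => n k Nn; have := NP n k Nn; have := le_lt_trans (sup_norm_ub g n) gM.
  rewrite /constant_family -[linf_fun (g - f) n]/(linf_fun g n - linf_fun f n).
  rewrite !ler_norml ltr_norml => /andP[? ?] /andP[? ?].
  by apply/andP; split; lra.
apply/ler_addgt0Pr => e e0; have [N NP] := fM _ e0.
have gb : ((fun n => if (n < N)%N then 0 else linf_fun f n) : nat -> R^o)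
    \in @linf_pred R nat.
  apply/linf_predP; exists (M + e) => n; case: ltnP => [_|Nn]; last exact: (NP n 0%N Nn).
  by rewrite normr0 (le_trans _ (NP N 0%N (leqnn _))).
have -> : \pi_(linf_c0 R nat) f = \pi_(linf_c0 R nat) (Linf gb).
  apply/eq_linf_c0/c0_tailP => d d0; exists N => n k Nn.
  rewrite /constant_family -[linf_fun _ n]/(linf_fun f n - if (n < N)%N then 0 else linf_fun f n).
  by rewrite ltnNge Nn /= subrr normr0 add0r ltW.
apply: le_trans (quot_norm_le _) _; apply: sup_norm_le => [|n].
  by rewrite (le_trans _ (NP N 0%N (leqnn _))).
rewrite /=; case: ltnP => [_|Nn]; last exact: (NP n 0%N Nn).
by rewrite normr0 (le_trans _ (NP N 0%N (leqnn _))).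
Qed.

Lemma pi_linf_c0_sum L (a : nat -> R) (f : nat -> linf R nat) :
  \pi_(linf_c0 R nat) (\sum_(i < L) a i *: f i) =
  \sum_(i < L) a i *: \pi_(linf_c0 R nat) (f i).
Proof.
elim: L => [|L IH]; first by rewrite !big_ord0 piE.
by rewrite !big_ord_recr /= pi_linf_c0D pi_linf_c0Z IH.
Qed.

Lemma constant_family_sum L (a : nat -> R) (f : nat -> linf R nat) :
  constant_family (\sum_(i < L) a i *: f i) =
  (fun n k => \sum_(i < L) a i * constant_family (f i) n k).
Proof.
apply/funext => n; apply/funext => k; elim: L => [|L IH]; first by rewrite !big_ord0.
by rewrite !big_ord_recr /= -IH.
Qed.

End tails.

Arguments constant_family {R} f n k : simpl never.

(** * The transferred automorphism *)

Section graphs.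
Context (R : realType).

(** The tuples [q] and [p] span isomorphic spaces, by the linear map sending [q i] to
[p i], and this map and its inverse have norm at most [C]. *)
Definition comparable_combinations (V : normedModType R) (C : R)
    (q p : nat -> V) :=
  forall L (a : nat -> R) M,
    (`|\sum_(i < L) a i *: q i| <= M -> `|\sum_(i < L) a i *: p i| <= C * M) /\
    (`|\sum_(i < L) a i *: p i| <= M -> `|\sum_(i < L) a i *: q i| <= C * M).

(** The bounds on combinations with value 0 make the relation single-valued, linear
and injective. *)
Lemma automorphism_of_graph (V : normedModType R) (Gamma : V -> V -> Prop) (C : R) :
  (forall q, exists p, Gamma q p) -> (forall p, exists q, Gamma q p) ->
  (forall q p : nat -> V, (forall i, Gamma (q i) (p i)) ->
     comparable_combinations C q p) ->
  exists T : {linear V -> V}, automorphism T /\ forall q p, Gamma q p -> T q = p.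
Proof.
move=> /choice[T TP] /choice[S SP] cmp.
pose c3 (a b c : R) i := if i is i'.+1 then (if i' is _.+1 then c else b) else a.
pose v3 (x y z : V) i := if i is i'.+1 then (if i' is _.+1 then z else y) else x.
have cmp3 a b c x y z x' y' z' M : Gamma x x' -> Gamma y y' -> Gamma z z' ->
    (`|a *: x + b *: y + c *: z| <= M -> `|a *: x' + b *: y' + c *: z'| <= C * M) /\
    (`|a *: x' + b *: y' + c *: z'| <= M -> `|a *: x + b *: y + c *: z| <= C * M).
  move=> hx hy hz; have [|h1 h2] := cmp (v3 x y z) (v3 x' y' z') _ 3 (c3 a b c) M.
    by case=> [|[|i]].
  by move: h1 h2; rewrite !big_ord_recr !big_ord0 /= !add0r.
have cmp1 x x' M : Gamma x x' -> (`|x| <= M -> `|x'| <= C * M) /\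
    (`|x'| <= M -> `|x| <= C * M).
  move=> h; have := cmp3 1 0 0 _ _ _ _ _ _ M h h h.
  by rewrite !scale1r !scale0r !addr0.
have linT : linear T.
  move=> a x y; have subrDD (u v w : V) : u - v - w = u - (v + w).
    by rewrite opprD addrA.
  have [+ _] := cmp3 1 (- a) (-1) _ _ _ _ _ _ 0 (TP (a *: x + y)) (TP x) (TP y).
  rewrite !scale1r !scaleNr !scale1r !subrDD subrr normr0 mulr0 => /(_ (lexx _)).
  by rewrite normr_le0 subr_eq0 => /eqP.
pose Tlin : {linear V -> V} := HB.pack T (GRing.isLinear.Build _ _ _ _ T linT).
have eq_of x y x' : Gamma x x' -> Gamma y x' -> x = y.
  move=> h1 h2; have [_ +] := cmp3 1 (-1) 0 _ _ _ _ _ _ 0 h1 h2 h2.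
  rewrite !scaleN1r !scale1r !scale0r !addr0 subrr normr0 mulr0 => /(_ (lexx _)).
  by rewrite normr_le0 subr_eq0 => /eqP.
have eq_of' x x' y' : Gamma x x' -> Gamma x y' -> x' = y'.
  move=> h1 h2; have [+ _] := cmp3 1 (-1) 0 _ _ _ _ _ _ 0 h1 h2 h2.
  rewrite !scaleN1r !scale1r !scale0r !addr0 subrr normr0 mulr0 => /(_ (lexx _)).
  by rewrite normr_le0 subr_eq0 => /eqP.
exists Tlin; split=> [|q p]; last exact/eq_of'/TP.
split; first by exists C => x; have [+ _] := cmp1 _ _ `|x| (TP x); apply.
exists S; split=> [x|y|].
- exact: eq_of (SP (T x)) (TP x).
- exact: eq_of' (TP (S y)) (SP y).
- by exists C => y; have [_ +] := cmp1 _ _ `|y| (SP y); apply.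
Qed.

Definition transfer_graph (rho1 rho2 : set ((nat -> nat -> R) * (nat -> nat -> R)))
    (q p : linf_c0 R nat) :=
  exists f F t, [/\ rho1 (constant_family f, F),
    rho2 (constant_family t, fun n => shuffle (F n)),
    q = \pi_(linf_c0 R nat) f & p = \pi_(linf_c0 R nat) t].

Lemma dyadic_rows_sum L (a : nat -> R) (g : nat -> nat -> R) :
  (forall i, dyadic_rows (g i)) ->
  dyadic_rows (fun k => \sum_(i < L) a i * g i k) /\
  shuffle (fun k => \sum_(i < L) a i * g i k) =
  (fun k => \sum_(i < L) a i * shuffle (g i) k).
Proof.
move=> gE; elim: L => [|L [IH1 IH2]].
  have -> : (fun k => \sum_(i < 0) a i * g i k) = (fun=> 0).
    by apply/funext => k; rewrite big_ord0.
  split; first by move=> e e0; exists 0%N => k k' _; rewrite subrr normr0.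
  by apply/funext => k; rewrite big_ord0 /shuffle; case: ifP => _; lra.
have -> : (fun k => \sum_(i < L.+1) a i * g i k) =
    (fun k => a L * g L k + \sum_(i < L) a i * g i k).
  by apply/funext => k; rewrite big_ord_recr addrC.
split.
  apply: dyadic_rowsD IH1 => e e0.
  have [m mP] := gE L (e / (`|a L| + 1)) (divr_gt0 e0 (ltr_wpDl (normr_ge0 _) ltr01)).
  exists m => k k' /mP; rewrite -mulrBr normrM ltr_pdivlMr ?ltr_wpDl//.
  apply: le_lt_trans; rewrite mulrC ler_wpM2l//; lra.
by rewrite shuffle_linear IH2; apply/funext => k; rewrite big_ord_recr addrC.
Qed.

Lemma tail_le_shuffle (F : nat -> nat -> R) M : (forall n, dyadic_rows (F n)) ->
  (tail_le F M -> tail_le (fun n => shuffle (F n)) (5 * M)) /\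
  (tail_le (fun n => shuffle (F n)) M -> tail_le F (5 * M)).
Proof.
move=> FE; split=> FM e e0; have e50 : 0 < e / 5 by lra.
  have [N NP] := FM _ e50; exists N => n k Nn.
  rewrite (_ : 5 * M + e = 5 * (M + e / 5)); last lra.
  by apply: shuffle_le => j; exact: NP.
have [N NP] := FM _ e50; exists N => n k Nn.
rewrite (_ : 5 * M + e = 5 * (M + e / 5)); last lra.
by apply: shuffle_ge => [|j]; [exact: FE|exact: NP].
Qed.

End graphs.

Section transfer.
Context (R : realType).
Context (rho1 rho2 : set ((nat -> nat -> R) * (nat -> nat -> R))).
Context (good1 : finitely_good (indiscernible (@constant_rows R) (@dyadic_rows R)) rho1).
Context (good2 : finitely_good (indiscernible (@constant_rows R) (@dyadic_plus_null_rows R)) rho2).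

(** Norms of combinations are preserved by the two matchings, and distorted by a
factor of at most 5 by [shuffle]. *)
Lemma transfer_graph_comparable q p : (forall i, transfer_graph rho1 rho2 (q i) (p i)) ->
  comparable_combinations 5 q p.
Proof.
move=> /choice[f fP] L a M; have [F FP] := choice fP; have [t qp] := choice FP.
pose s1 i := (constant_family (f i), F i).
pose s2 i := (constant_family (t i), fun n => shuffle (F i n)).
have [FE FG GF] : indiscernible (@constant_rows R) (@dyadic_rows R) L s1.
  by apply: good1 => i _; have [] := qp i.
have [_ FG' GF'] : indiscernible (@constant_rows R) (@dyadic_plus_null_rows R) L s2.
  by apply: good2 => i _; have [] := qp i.
have {}FE i n : dyadic_rows (F i n).
  have [/(_ 0%N isT)[_ [_ h]] _ _] :
    indiscernible (@constant_rows R) (@dyadic_rows R) 1 (fun=> s1 i).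
    by apply: good1 => j _; have [] := qp i.
  exact: h.
have qE : \sum_(i < L) a i *: q i = \pi_(linf_c0 R nat) (\sum_(i < L) a i *: f i).
  by rewrite pi_linf_c0_sum; apply: eq_bigr => i _; have [_ _ ->] := qp i.
have pE : \sum_(i < L) a i *: p i = \pi_(linf_c0 R nat) (\sum_(i < L) a i *: t i).
  by rewrite pi_linf_c0_sum; apply: eq_bigr => i _; have [_ _ _ ->] := qp i.
have FnE n := dyadic_rows_sum L a (fun i => FE i n).
have [S1 S2] := @tail_le_shuffle R (fun n k => \sum_(i < L) a i * F i n k) M
  (fun n => (FnE n).1).
have SE : (fun n => shuffle (fun k => \sum_(i < L) a i * F i n k)) =
    (fun n k => \sum_(i < L) a i * shuffle (F i n) k).
  by apply/funext => n; have [_ ->] := FnE n.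
rewrite SE in S1 S2; rewrite qE pE; split=> /norm_tailP; rewrite constant_family_sum => h;
  apply/norm_tailP; rewrite constant_family_sum.
- apply: (tail_le_shadows GF'); apply: S1.
  exact: (tail_le_shadows FG h).
- apply: (tail_le_shadows GF); apply: S2.
  exact: (tail_le_shadows FG' h).
Qed.

Context (total1 : forall F, families (@constant_rows R) F -> exists G, rho1 (F, G)).
Context (onto1 : forall G, families (@dyadic_rows R) G -> exists F, rho1 (F, G)).
Context (total2 : forall F, families (@constant_rows R) F -> exists G, rho2 (F, G)).
Context (onto2 : forall G, families (@dyadic_plus_null_rows R) G -> exists F, rho2 (F, G)).

Lemma shuffle_families F : families (@dyadic_rows R) F ->
  families (@dyadic_plus_null_rows R) (fun n => shuffle (F n)).
Proof.
move=> [[M FM] FE]; split; last by move=> n; exact: shuffle_rows.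
by exists (5 * M) => n k; apply: shuffle_le.
Qed.

Lemma rho1_families F G : rho1 (F, G) ->
  families (@constant_rows R) F /\ families (@dyadic_rows R) G.
Proof.
move=> h; have [] := good1 (L := 1) (p := fun=> (F, G)) (fun _ _ => h).
by move=> /(_ 0%N isT).
Qed.

Lemma rho2_families F G : rho2 (F, G) ->
  families (@constant_rows R) F /\ families (@dyadic_plus_null_rows R) G.
Proof.
move=> h; have [] := good2 (L := 1) (p := fun=> (F, G)) (fun _ _ => h).
by move=> /(_ 0%N isT).
Qed.

Lemma transfer_graph_total q : exists p, transfer_graph rho1 rho2 q p.
Proof.
have [f qf] := linf_c0W q.
have [F hF] := total1 ((families_constantP _).2 (ex_intro _ f erefl)).
have [_ FE] := rho1_families hF.
have [t' ht] := onto2 (shuffle_families FE).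
have [/families_constantP[t tE] _] := rho2_families ht; rewrite tE in ht.
by exists (\pi_(linf_c0 R nat) t), f, F, t.
Qed.

Lemma transfer_graph_onto p : exists q, transfer_graph rho1 rho2 q p.
Proof.
have [t pt] := linf_c0W p.
have [G hG] := total2 ((families_constantP _).2 (ex_intro _ t erefl)).
have [_ [[M GM] GE]] := rho2_families hG.
have /choice[F FP] : forall n, exists g, dyadic_rows g /\ shuffle g = G n.
  by move=> n; have [g h1 h2] := shuffle_onto (GE n); exists g.
have FE : families (@dyadic_rows R) F.
  split=> [|n]; last by have [] := FP n.
  exists (5 * M) => n; apply: shuffle_ge; first by have [] := FP n.
  by move=> k; have [_ ->] := FP n.
have [f' hf] := onto1 FE.
have [/families_constantP[f fE] _] := rho1_families hf; rewrite fE in hf.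
exists (\pi_(linf_c0 R nat) f), f, F, t; split => //.
by have <- : G = (fun n => shuffle (F n)) by apply/funext => n; have [_ ->] := FP n.
Qed.

End transfer.

(** * Corners of the automorphism that vanish *)

Lemma indic_linf_subproof (R : realType) (A : set nat) : (\1_A : nat -> R^o) \in @linf_pred R nat.
Proof.
by apply/linf_predP; exists 1 => n; rewrite indicE; case: (n \in A); rewrite ?normr1 ?normr0.
Qed.

Definition indic_linf (R : realType) (A : set nat) : linf R nat :=
  Linf (indic_linf_subproof R A).

(** The obstruction to quasi-open canonizations: the corner of [T] from [A2] to [B']
kills the unit of its domain, and [A1] can be prescribed after [B'], so that [A2]
can be placed inside any set that [B'] determines. *)
Definition locally_vanishing (R : realType) (T : linf_c0 R nat -> linf_c0 R nat) :=
  forall B, infinite_set B ->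
  exists B' : set nat, [/\ infinite_set B', B' `<=` B &
    forall A1, infinite_set A1 -> exists (A2 : set nat) (t : linf R nat),
      [/\ infinite_set A2, A2 `<=` A1,
          T (\pi_(linf_c0 R nat) (indic_linf R A2)) = \pi_(linf_c0 R nat) t &
          forall e : R, 0 < e -> exists N, forall n, (N <= n)%N -> B' n ->
            `|(linf_fun t n : R)| < e]].

Section killing.
Context (R : realType).

Lemma constant_family_indic (A : set nat) n k :
  constant_family (indic_linf R A) n k = (n \in A)%:R.
Proof. by rewrite /constant_family /= indicE. Qed.

Lemma good_pair E E' (rho : set ((nat -> nat -> R) * (nat -> nat -> R))) p q :
  finitely_good (indiscernible E E') rho -> rho p -> rho q ->
  (forall e : R, 0 < e -> exists N, forall z, (N <= z.1)%N -> forall M, exists y,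
     [/\ (M <= y.1)%N, `|p.1 y.1 y.2 - p.2 z.1 z.2| < e &
         `|q.1 y.1 y.2 - q.2 z.1 z.2| < e]) /\
  (forall e : R, 0 < e -> exists N, forall y, (N <= y.1)%N -> forall M, exists z,
     [/\ (M <= z.1)%N, `|p.1 y.1 y.2 - p.2 z.1 z.2| < e &
         `|q.1 y.1 y.2 - q.2 z.1 z.2| < e]).
Proof.
move=> grho rp rq.
have [|_ FG GF] := grho 2 (fun i => if i is 0%N then p else q); first by case=> [|[|[]]].
split=> e e0.
  have [N NP] := FG e e0; exists N => z /NP h M; have [y My yz] := h M.
  by exists y; split=> //; [exact: (yz 0%N)|exact: (yz 1%N)].
have [N NP] := GF e e0; exists N => z /NP h M; have [y My yz] := h M.
by exists y; rewrite ![`|_ - _ y.1 y.2|]distrC; split=> //; [exact: (yz 0%N)|exact: (yz 1%N)].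
Qed.

Lemma quarters_disjoint (x : R) : `|x| < 1 / 4 -> `|x - 1| < 1 / 4 -> False.
Proof. by rewrite !ltr_norml => /andP[? ?] /andP[? ?]; lra. Qed.

(** A nonempty clopen set of 2-adic integers contains a smaller one without elements
of [nat] up to [P]. *)
Lemma avoiding_row (f : nat -> R) P : dyadic_rows f -> exists h : nat -> R,
  [/\ dyadic_rows h, forall x, h x = 0 \/ h x = 1,
      forall x, (x <= P)%N -> h x = 0,
      forall x, h x = 1 -> `|f x - 1| < 1 / 2 &
      (exists k, `|f k - 1| < 1 / 4) -> exists x, h x = 1].
Proof.
move=> fE; have [[k fk]|nk] := pselect (exists k, `|f k - 1| < 1 / 4); last first.
  exists (fun=> 0); split => //; try by [left|move=> x /eqP; rewrite eq_sym oner_eq0].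
  by move=> e e0; exists 0%N => x y _; rewrite subrr normr0.
have [m mP] : exists m, forall x y, (x = y %[mod 2 ^ m])%N -> `|f x - f y| < 1 / 4.
  by apply: fE; lra.
(* As c < 2 ^ (m + c), the residue class of c modulo 2 ^ (m + c) has c as its least
   element. *)
pose c := (P.+1 * 2 ^ m + k)%N.
have cP : (P < c)%N by rewrite /c (leq_trans _ (leq_addr _ _))// leq_pmulr// expn_gt0.
have mod_c : (c %% 2 ^ (m + c))%N = c.
  by rewrite modn_small// (leq_trans (ltn_expl c (isT : 1 < 2)%N))// leq_exp2l// leq_addl.
exists (fun x => ((x %% 2 ^ (m + c))%N == c)%:R); split.
- by move=> e e0; exists (m + c)%N => x y ->; rewrite subrr normr0.
- by move=> x; case: eqP; [right|left].
- move=> x xP; case: eqP => // xc.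
  by have := leq_trans cP (leq_trans (eq_leq (esym xc)) (leq_trans (leq_mod _ _) xP)); rewrite ltnn.
- move=> x; case: eqP => [xc _|_ /eqP]; last by rewrite eq_sym oner_eq0.
  have : `|f x - f k| < 1 / 4.
    by apply: mP; rewrite -(modn_exp2 x (leq_addr c m)) xc /c modnMDl.
  by move: fk; rewrite !ltr_norml => /andP[? ?] /andP[? ?]; apply/andP; split; lra.
- by move=> _; exists c; rewrite mod_c eqxx.
Qed.

Context (rho1 rho2 : set ((nat -> nat -> R) * (nat -> nat -> R))).
Context (good1 : finitely_good (indiscernible (@constant_rows R) (@dyadic_rows R)) rho1).
Context (good2 : finitely_good (indiscernible (@constant_rows R) (@dyadic_plus_null_rows R)) rho2).
Context (total1 : forall F, families (@constant_rows R) F -> exists G, rho1 (F, G)).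
Context (onto1 : forall G, families (@dyadic_rows R) G -> exists F, rho1 (F, G)).
Context (total2 : forall F, families (@constant_rows R) F -> exists G, rho2 (F, G)).
Context (onto2 : forall G, families (@dyadic_plus_null_rows R) G -> exists F, rho2 (F, G)).

Let total1' (f : linf R nat) : exists G, rho1 (constant_family f, G).
Proof. by apply: total1; apply/families_constantP; exists f. Qed.

Let total2' (f : linf R nat) : exists G, rho2 (constant_family f, G).
Proof. by apply: total2; apply/families_constantP; exists f. Qed.

Let onto1' G : families (@dyadic_rows R) G -> exists f, rho1 (constant_family f, G).
Proof.
move=> /onto1[F hF]; have [/families_constantP[f fE] _] := rho1_families good1 hF.
by exists f; rewrite -fE.
Qed.

Let onto2' G : families (@dyadic_plus_null_rows R) G ->
  exists f, rho2 (constant_family f, G).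
Proof.
move=> /onto2[F hF]; have [/families_constantP[f fE] _] := rho2_families good2 hF.
by exists f; rewrite -fE.
Qed.

(** The family representing the indicator of [B] is close to 1 at a point
[kappa n] of infinitely many rows. The indicator [V] of these isolated points
has its rows in [dyadic_plus_null_rows], and [v] represents it on [nat]. *)
Lemma isolated_refinement (B : set nat) : infinite_set B ->
  exists (B' : set nat) (v : linf R nat) V (kappa : nat -> nat),
    [/\ infinite_set B', B' `<=` B, rho2 (constant_family v, V),
        forall n, B' n -> `|(linf_fun v n : R) - 1| < 1 / 4 &
        forall n k, V n k != 0 -> k = kappa n].
Proof.
move=> infB; have [G hG] := total2' (indic_linf R B).
have /choice[kappa kappaP] : forall n, exists k0,
    forall k, `|G n k - 1| < 1 / 4 -> `|G n k0 - 1| < 1 / 4.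
  move=> n; have [[k h]|nk] := pselect (exists k, `|G n k - 1| < 1 / 4).
    by exists k.
  by exists 0%N => k h; case: nk; exists k.
pose hit n := `|G n (kappa n) - 1| < 1 / 4.
pose V (n k : nat) : R := (hit n && (k == kappa n))%:R.
have VE : families (@dyadic_plus_null_rows R) V.
  split.
    by exists 1 => n k; rewrite /V; case: (_ && _); rewrite ?normr1 ?normr0.
  move=> n; exists (fun=> 0), (V n); split.
  - by move=> e e0; exists 0%N => x y _; rewrite subrr normr0.
  - move=> e e0; exists (kappa n).+1 => k kn; rewrite /V (gtn_eqF kn).
    by case: (hit n); rewrite mulr0n normr0.
  - by apply/funext => k; rewrite add0r.
have [v hv] := onto2' VE.
exists (B `&` [set n | `|(linf_fun v n : R) - 1| < 1 / 4]), v, V, kappa.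
split => //; last 2 first.
- by move=> n [].
- by move=> n k; rewrite /V; case: (k =P kappa n) => // _; rewrite andbF mulr0n eqxx.
have [shad1 shad2] := good_pair good2 hG hv.
have e40 : 0 < 1 / 4 :> R by lra.
have [N NP] := shad2 _ e40; have [N' NP'] := shad1 _ e40.
apply/infinite_natP => M.
have [n Nn Bn] := (infinite_natP B).1 infB N.
have [y [Ny Gy _]] := NP (n, 0%N) Nn N'.
have Gy1 : hit y.1.
  apply: (kappaP _ y.2); move: Gy; rewrite /= constant_family_indic mem_set//.
  by rewrite distrC.
have [x [Mx xG xV]] := NP' (y.1, kappa y.1) Ny M.
move: xG xV; rewrite /= constant_family_indic /V /= Gy1 eqxx /= /constant_family => xG xV.
exists x.1 => //; split=> //=; apply: contrapT => nBx.
move: xG Gy1; rewrite memNset// mulr0n /hit !ltr_norml => /andP[? ?] /andP[? ?]; lra.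
Qed.

(** Rows on which the indicator of [A1] is represented by values close to 1 are shrunk
to clopen sets that contain none of the five points on which
[shuffle _ (kappa n)] depends. *)
Lemma avoiding_refinement (kappa : nat -> nat) (A1 : set nat) : infinite_set A1 ->
  exists (A2 : set nat) (w : linf R nat) W,
    [/\ infinite_set A2, A2 `<=` A1, rho1 (constant_family w, W),
        \pi_(linf_c0 R nat) w = \pi_(linf_c0 R nat) (indic_linf R A2) &
        forall n, shuffle (W n) (kappa n) = 0].
Proof.
move=> infA; have [G hG] := total1' (indic_linf R A1).
have [_ [_ GE]] := rho1_families good1 hG.
(* A bound for the points at which shuffle _ (kappa n) evaluates its argument. *)
pose P n := (kappa n + 2 ^ (logn 2 (kappa n)).*2 + 2 ^ logn 2 (kappa n) +
  2 ^ (kappa n).*2.+1)%N.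
have /choice[W WP] := fun n => avoiding_row (P n) (GE n).
have WE : families (@dyadic_rows R) W.
  split=> [|n]; last by have [] := WP n.
  by exists 1 => n k; have [_ /(_ k)[->|->] _ _ _] := WP n; rewrite ?normr0 ?normr1.
have [w hw] := onto1' WE.
have [shad1 shad2] := good_pair good1 hG hw.
pose A2 := A1 `&` [set n | `|(linf_fun w n : R) - 1| < 1 / 4].
have e40 : 0 < 1 / 4 :> R by lra.
have [N NP] := shad2 _ e40; have [N' NP'] := shad1 _ e40.
exists A2, w, W; split => //.
- apply/infinite_natP => M.
  have [n Nn An] := (infinite_natP A1).1 infA N.
  have [y [Ny Gy _]] := NP (n, 0%N) Nn N'.
  move: Gy; rewrite /= constant_family_indic mem_set// => Gy.
  have [_ _ _ W1 /(_ _)[|k Wk]] := WP y.1.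
    by exists y.2; rewrite distrC.
  have [x [Mx xG xW]] := NP' (y.1, k) Ny M.
  move: xG xW; rewrite /= constant_family_indic /= Wk /constant_family => xG xW.
  exists x.1 => //; split=> //=; apply: contrapT => nAx.
  by move: xG (W1 k Wk); rewrite memNset// mulr0n !ltr_norml => /andP[? ?] /andP[? ?]; lra.
- by move=> n [].
(* W takes the values 0 and 1 only, so w is asymptotically an indicator. *)
- apply/eq_linf_c0/c0_tailP => e e0.
  pose d : R := Num.min e (1 / 4).
  have d0 : 0 < d by rewrite lt_min e0.
  have [N1 N1P] := shad2 _ d0; exists N1 => n k N1n.
  rewrite /constant_family -[linf_fun _ n]/(linf_fun w n - \1_A2 n) indicE add0r.
  have [y [_ Gy Wy]] := N1P (n, 0%N) N1n 0%N.
  move: Gy Wy; rewrite /= constant_family_indic /constant_family !lt_min /=.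
  move=> /andP[_ Gy] /andP[Wy1 Wy2].
  have [_ W01 _ W1 _] := WP y.1.
  have [Wy|Wy] := W01 y.2.
    rewrite memNset ?subr0; first by move: Wy1; rewrite Wy subr0 => /ltW.
    by move=> [_ /=]; move: Wy2; rewrite Wy !ltr_norml => /andP[? ?] /andP[? ?]; lra.
  rewrite mem_set; first by move: Wy1; rewrite Wy => /ltW.
  split; last by move: Wy2; rewrite Wy.
  apply: contrapT => nA; move: Gy (W1 _ Wy); rewrite memNset// mulr0n !ltr_norml.
  by move=> /andP[? ?] /andP[? ?]; lra.
- move=> n; have [_ _ W0 _ _] := WP n.
  have [P1 P2 P3 P4] : [/\ kappa n <= P n, 2 ^ (logn 2 (kappa n)).*2 <= P n,
      2 ^ logn 2 (kappa n) <= P n & 2 ^ (kappa n).*2.+1 <= P n]%N.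
    by rewrite /P; split; lia.
  by rewrite /shuffle !W0// !subr0 if_same !addr0.
Qed.

(** On [B'] the function [v] is close to 1, so late points of [B'] can only be shadowed
by the isolated points [kappa n], where the image of [W] is 0. *)
Lemma transfer_locally_vanishing (T : linf_c0 R nat -> linf_c0 R nat) :
  (forall q p, transfer_graph rho1 rho2 q p -> T q = p) -> locally_vanishing T.
Proof.
move=> TP B /isolated_refinement[B' [v [V [kappa [infB' B'B hv vB' VK]]]]].
exists B'; split => // A1 /(avoiding_refinement kappa)[A2 [w [W [infA2 A21 hw wE W0]]]].
have [_ WE] := rho1_families good1 hw.
have [t ht] := onto2' (shuffle_families WE).
exists A2, t; split => //; first by rewrite -wE; apply: TP; exists w, W, t.
move=> e e0; pose d : R := Num.min e (1 / 4).
have d0 : 0 < d by rewrite lt_min e0 /=; lra.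
have [_ /(_ _ d0)[N NP]] := good_pair good2 hv ht.
exists N => n Nn B'n; have [y [_]] := NP (n, 0%N) Nn 0%N.
rewrite /constant_family !lt_min /= => /andP[_ Vy] /andP[ty _].
have yk : y.2 = kappa y.1.
  apply: VK; apply/eqP => Vy0; rewrite Vy0 subr0 in Vy.
  exact: (quarters_disjoint Vy (vB' n B'n)).
by move: ty; rewrite yk W0 subr0.
Qed.

End killing.

(** * Quasi-open canonizations *)

Lemma infinite_star (D : set nat) : infinite_set D -> exists u, star D u.
Proof.
move=> Dinf.
have FF : ProperFilter (within D (@frechet_filter nat)).
  split; last exact: within_filter.
  rewrite /within /frechet_filter /= => fD; apply: Dinf.
  by apply: sub_finite_set fD => n Dn; exact.
have [U [UU DU]] := ultraFilterLemma FF.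
exists (BetaN UU); apply/starP; split=> [|C fC]; apply: DU.
  rewrite /within /frechet_filter /=.
  by apply: (sub_finite_set _ (finite_set0 nat)) => n /=; exact.
rewrite /within /frechet_filter /=.
by apply: sub_finite_set fC => n /= nC Cn; apply: nC.
Qed.

Lemma star_infinite (D : set nat) u : star D u -> infinite_set D.
Proof.
move=> /starP[uD uF] fD; have := uF (~` D); rewrite setCK => /(_ fD) uDC.
by have [n []] := ultra_meet _ uD uDC.
Qed.

Lemma star_sub (A B : set nat) u : A `<=` B -> star A u -> star B u.
Proof.
by move=> AB /starP[uA uF]; apply/starP; split => //; exact: filterS uA.
Qed.

Lemma beta_ext_eq_cst (R : realType) (f : linf R nat) (u : betaN) (c : R) :
  (forall e : R, 0 < e -> ultra_of u [set n | `|(linf_fun f n : R) - c| < e]) ->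
  beta_ext f u = c.
Proof.
move=> fc; apply/eqP; rewrite -subr_eq0 -normr_le0; apply/ler_addgt0Pr => e e0.
have e20 : 0 < e / 2 by lra.
have [n [h1 h2]] := ultra_meet _ (beta_ext_approx f u e20) (fc _ e20).
move: h1 h2; rewrite add0r /= !ltr_norml ler_norml => /andP[? ?] /andP[? ?].
by apply/andP; split; lra.
Qed.

Lemma nbhs_set_type (A : set betaN) (U : set A) (x : A) : nbhs x U ->
  exists C, ultra_of (\val x) C /\ forall y : A, ultra_of (\val y) C -> U y.
Proof.
rewrite nbhsE /= => -[V [[W oW WV] Vx] VU].
have /nbhs_betaN[C xC CW] : nbhs (\val x) W.
  by apply: open_nbhs_nbhs; split => //; rewrite -WV in Vx.
by exists C; split => // y /CW Wy; apply: VU; rewrite -WV.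
Qed.

Lemma ext0_restr (R : realType) (A : set nat) (f : linf R nat) n : A n ->
  linf_fun (ext0 (restr A f)) n = linf_fun f n.
Proof.
by move=> An; exact: (@valL0_in R A (linf_fun (restr A f)) (SigSub (mem_set An))).
Qed.

(** Quasi-openness yields an infinite [A1] whose remainder is covered by the image of
the remainder of [B']; the refinement [A2] then contradicts [r != 0]. *)
Lemma not_canonizable (R : realType) (T : linf_c0 R nat -> linf_c0 R nat) :
  locally_vanishing T ->
  forall (A B : set nat) (psi : star B -> star A),
    infinite_set A -> infinite_set B -> quasi_open psi -> ~ canonizable_along T psi.
Proof.
move=> kills A B psi infA infB [psic psio] [_ _ [r r0 canon]].
have [B' [infB' B'B B'K]] := kills B infB.
pose U : set (star B) := [set u | ultra_of (\val u) B'].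
have oU : open U.
  have valc : continuous (\val : star B -> betaN) by exact: initial_continuous.
  by have /continuousP/(_ _ (betaN_basic_open B')) := valc.
have [u0 u0B'] := infinite_star infB'.
have U0 : U !=set0.
  exists (SigSub (mem_set (star_sub B'B u0B'))).
  by have /starP[] := u0B'.
have [a /nbhs_set_type[A0 [aA0 A0U]]] := psio U oU U0.
have aA : star A (\val a) by exact: set_valP.
have infA1 : infinite_set (A `&` A0).
  apply: (@star_infinite _ (\val a)); have /starP[aA' aF] := aA; apply/starP.
  by split => //; exact: filterI.
have [A2 [t [infA2 A21 TA2 tK]]] := B'K _ infA1.
have A2A : A2 `<=` A by move=> n /A21[].
have [a2 a2A2] := infinite_star infA2.
have a2A := star_sub A2A a2A2.
have [a2A2' _] := (starP _ _).1 a2A2.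
have [u uB' psiu] : (psi @` U) (SigSub (mem_set a2A)).
  by apply: A0U; apply: filterS a2A2' => n /A21[].
pose q := \pi_(linf_c0 R A) (restr A (indic_linf R A2)).
have extq : linf_c0_ext q = \pi_(linf_c0 R nat) (indic_linf R A2).
  rewrite linf_c0_ext_pi; congr (\pi_(linf_c0 R nat) _); apply/val_inj/funext => n.
  have [An|An] := pselect (A n); first exact: ext0_restr.
  by rewrite -[LHS]/('valL_0 _ n) valL0_out// /= indicE memNset// => /A2A.
have := canon (star_fun q) u.
rewrite /corner_star star_funK /corner extq TA2 linf_c0_restr_pi star_funE psiu star_funE.
have [uB uF] := (starP B (\val u)).1 (set_valP u).
have -> : beta_ext (ext0 (restr B t)) (\val u) = 0.
  apply: beta_ext_eq_cst => e e0; have [N NP] := tK e e0.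
  have late : ultra_of (\val u) [set n | (N <= n)%N].
    by apply: uF; apply/finite_natP; exists N => n Nn /=; rewrite Nn.
  apply: filterS (filterI uB' late) => n [B'n Nn]; rewrite /mkset subr0.
  by rewrite ext0_restr; [exact: NP|exact: B'B].
have -> : beta_ext (ext0 (restr A (indic_linf R A2)))
    (\val (SigSub (mem_set a2A) : star A)) = 1.
  apply: beta_ext_eq_cst => e e0; apply: filterS a2A2' => n A2n; rewrite /mkset.
  rewrite ext0_restr; last exact: A2A.
  by rewrite /= indicE mem_set// subrr normr0.
by move/esym/eqP; rewrite mulr1 (negbTE r0).
Qed.

Theorem theorem6p5 (R : realType) (CH : continuum_hypothesis R) :
  exists T : {linear linf_c0 R nat -> linf_c0 R nat},
    [/\ automorphism T,
        ~ (exists (A B : set nat) (psi : star B -> star A),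
            [/\ infinite_set A, infinite_set B, quasi_open psi &
                canonizable_along T psi]) &
        ~ (exists (A B : set nat) (psi : star B -> star A),
            [/\ infinite_set A, infinite_set B, homeomorphism psi &
                canonizable_along T psi])].
Proof.
have [rho1 [good1 total1 onto1]] := matching_exists CH
  (@constant_rows_approximable R) (@dyadic_rows_approximable R).
have [rho2 [good2 total2 onto2]] := matching_exists CH
  (@constant_rows_approximable R) (@dyadic_plus_null_rows_approximable R).
have [T [autT TP]] := automorphism_of_graph
  (transfer_graph_total good1 good2 total1 onto2)
  (transfer_graph_onto good1 good2 onto1 total2)
  (transfer_graph_comparable good1 good2).
have nowhere := not_canonizable
  (transfer_locally_vanishing good1 good2 total1 onto1 total2 onto2 TP).
exists T; split=> // -[A [B [psi [infA infB psiP canon]]]].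
  exact: (nowhere A B psi infA infB psiP canon).
exact: (nowhere A B psi infA infB (homeomorphism_quasi_open psiP) canon).
Qed.
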